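(* Let $R>0$, let $B=B(0,R)\subset\mathbb{H}$, and let $f : B \to \mathbb{H}$ be a regular function. If $|f|$ has a local minimum point $p\in B$, then either $f(p)=0$ or $f$ is constant.
   Context: $\mathbb{H}$ is the skew field of real quaternions, with the usual norm $|\cdot|$, and $B(0,R)=\{q\in\mathbb{H}:|q|<R\}$. Let $\mathbb{S}=\{q\in\mathbb{H}:q^2=-1\}$ be the 2-sphere of imaginary units and, for $I\in\mathbb{S}$, let $L_I=\mathbb{R}+I\mathbb{R}$. A real differentiable function $f:\Omega\to\mathbb{H}$ on a domain $\Omega\subseteq\mathbb{H}$ is called regular (Cullen-regular) if for every $I\in\mathbb{S}$ the restriction $f_I$ of $f$ to $\Omega\cap L_I$ satisfies $\frac12\left(\frac{\partial}{\partial x}+I\frac{\partial}{\partial y}\right)f_I(x+Iy)=0$ at every point $x+Iy$ of $\Omega\cap L_I$ ($x,y\in\mathbb{R}$). *)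

(* Defs.v *)
From HB Require Import structures.
From mathcomp Require Import all_boot all_order all_algebra.
From mathcomp Require Import all_classical all_reals all_analysis.
From mathcomp Require Import ring lra.

Set Implicit Arguments.
Unset Strict Implicit.
Unset Printing Implicit Defensive.

Import Order.TTheory GRing.Theory Num.Theory.
Import numFieldNormedType.Exports.

Local Open Scope classical_set_scope.
Local Open Scope ring_scope.

(* [Quat a b c d] is a + b i + c j + d k. *)
Record quaternion (R : Type) :=
  Quat { quat_re : R; quat_i : R; quat_j : R; quat_k : R }.

Definition tuple_of_quat (R : Type) (q : quaternion R) : R * R * R * R :=
  (quat_re q, quat_i q, quat_j q, quat_k q).

Definition quat_of_tuple (R : Type) (t : R * R * R * R) : quaternion R :=
  let: (a, b, c, d) := t in Quat a b c d.

Lemma tuple_of_quatK (R : Type) :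
  cancel (@tuple_of_quat R) (@quat_of_tuple R).
Proof. by case. Qed.

HB.instance Definition _ (R : choiceType) :=
  Choice.copy (quaternion R) (can_type (@tuple_of_quatK R)).

Section QuaternionAlgebra.
Context {R : realType}.
Implicit Types (p q r : quaternion R) (s t : R).

Lemma quat_ext p q :
  quat_re p = quat_re q -> quat_i p = quat_i q ->
  quat_j p = quat_j q -> quat_k p = quat_k q -> p = q.
Proof. by case: p => ????; case: q => ???? /= -> -> -> ->. Qed.

Definition add_quat p q :=
  Quat (quat_re p + quat_re q) (quat_i p + quat_i q)
       (quat_j p + quat_j q) (quat_k p + quat_k q).

Definition opp_quat p :=
  Quat (- quat_re p) (- quat_i p) (- quat_j p) (- quat_k p).

Lemma add_quatA : associative add_quat.
Proof. by move=> p q r; apply: quat_ext; rewrite /= addrA. Qed.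

Lemma add_quatC : commutative add_quat.
Proof. by move=> p q; apply: quat_ext; rewrite /= addrC. Qed.

Lemma add0quat : left_id (Quat 0 0 0 0) add_quat.
Proof. by move=> p; apply: quat_ext; rewrite /= add0r. Qed.

Lemma addNquat : left_inverse (Quat 0 0 0 0) opp_quat add_quat.
Proof. by move=> p; apply: quat_ext; rewrite /= addNr. Qed.

HB.instance Definition _ :=
  GRing.isZmodule.Build (quaternion R) add_quatA add_quatC add0quat addNquat.

Definition mul_quat p q :=
  let: Quat a b c d := p in
  let: Quat a' b' c' d' := q in
  Quat (a * a' - b * b' - c * c' - d * d')
       (a * b' + b * a' + c * d' - d * c')
       (a * c' - b * d' + c * a' + d * b')
       (a * d' + b * c' - c * b' + d * a').

Lemma mul_quatA : associative mul_quat.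
Proof. by case=> [????] [????] [????]; apply: quat_ext => /=; ring. Qed.

Lemma mul1quat : left_id (Quat 1 0 0 0) mul_quat.
Proof. by case=> [????]; apply: quat_ext => /=; ring. Qed.

Lemma mul_quat1 : right_id (Quat 1 0 0 0) mul_quat.
Proof. by case=> [????]; apply: quat_ext => /=; ring. Qed.

Lemma mul_quatDl : left_distributive mul_quat +%R.
Proof. by case=> [????] [????] [????]; apply: quat_ext => /=; ring. Qed.

Lemma mul_quatDr : right_distributive mul_quat +%R.
Proof. by case=> [????] [????] [????]; apply: quat_ext => /=; ring. Qed.

Lemma one_quat_neq0 : Quat 1 0 0 0 != 0 :> quaternion R.
Proof. by apply/eqP => -[] /eqP; rewrite oner_eq0. Qed.

HB.instance Definition _ := GRing.Zmodule_isNzRing.Build (quaternion R)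
  mul_quatA mul1quat mul_quat1 mul_quatDl mul_quatDr one_quat_neq0.

Definition scale_quat s p :=
  Quat (s * quat_re p) (s * quat_i p) (s * quat_j p) (s * quat_k p).

Lemma scale_quatA s t p : scale_quat s (scale_quat t p) = scale_quat (s * t) p.
Proof. by apply: quat_ext; rewrite /= mulrA. Qed.

Lemma scale1quat : left_id 1 scale_quat.
Proof. by move=> p; apply: quat_ext; rewrite /= mul1r. Qed.

Lemma scale_quatDr : right_distributive scale_quat +%R.
Proof. by move=> s p q; apply: quat_ext; rewrite /= mulrDr. Qed.

Lemma scale_quatDl p : {morph scale_quat^~ p : s t / s + t}.
Proof. by move=> s t; apply: quat_ext; rewrite /= mulrDl. Qed.

HB.instance Definition _ := GRing.Zmodule_isLmodule.Build R (quaternion R)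
  scale_quatA scale1quat scale_quatDr scale_quatDl.

Lemma scale_quatAl s p q : s *: (p * q) = (s *: p) * q.
Proof. by case: p q => [????] [????]; apply: quat_ext => /=; ring. Qed.

HB.instance Definition _ :=
  GRing.Lmodule_isLalgebra.Build R (quaternion R) scale_quatAl.

Lemma scale_quatAr s p q : s *: (p * q) = p * (s *: q).
Proof. by case: p q => [????] [????]; apply: quat_ext => /=; ring. Qed.

HB.instance Definition _ :=
  GRing.Lalgebra_isAlgebra.Build R (quaternion R) scale_quatAr.

Definition norm_quat p :=
  Num.sqrt (quat_re p ^+ 2 + quat_i p ^+ 2 + quat_j p ^+ 2 + quat_k p ^+ 2).

Lemma norm_quat_arg_ge0 p :
  0 <= quat_re p ^+ 2 + quat_i p ^+ 2 + quat_j p ^+ 2 + quat_k p ^+ 2.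
Proof. by rewrite !addr_ge0 // sqr_ge0. Qed.

Lemma ler_norm_quatD p q : norm_quat (p + q) <= norm_quat p + norm_quat q.
Proof.
have dot_le :
    quat_re p * quat_re q + quat_i p * quat_i q
    + quat_j p * quat_j q + quat_k p * quat_k q
    <= norm_quat p * norm_quat q.
  rewrite -sqrtrM ?norm_quat_arg_ge0 //.
  apply: le_trans (ler_norm _) _; rewrite -sqrtr_sqr ler_wsqrtr //.
  rewrite -subr_ge0.
  have -> : forall a b c d a' b' c' d' : R,
    (a ^+ 2 + b ^+ 2 + c ^+ 2 + d ^+ 2)
      * (a' ^+ 2 + b' ^+ 2 + c' ^+ 2 + d' ^+ 2)
      - (a * a' + b * b' + c * c' + d * d') ^+ 2
    = (a * b' - b * a') ^+ 2 + (a * c' - c * a') ^+ 2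
      + (a * d' - d * a') ^+ 2 + (b * c' - c * b') ^+ 2
      + (b * d' - d * b') ^+ 2 + (c * d' - d * c') ^+ 2.
    by move=> *; ring.
  by rewrite !addr_ge0 // sqr_ge0.
have norm_ge0 x : 0 <= norm_quat x by exact: sqrtr_ge0.
rewrite -(@ler_pXn2r _ 2) ?nnegrE ?addr_ge0 //.
rewrite sqrrD !sqr_sqrtr ?norm_quat_arg_ge0 //=.
lra.
Qed.

Lemma norm_quatZ s p : norm_quat (s *: p) = `|s| * norm_quat p.
Proof.
rewrite -sqrtr_sqr -sqrtrM ?sqr_ge0 //.
by congr Num.sqrt => /=; ring.
Qed.

Lemma norm_quat0_eq0 p : norm_quat p = 0 -> p = 0.
Proof.
move/eqP; rewrite sqrtr_eq0 => p_le0.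
have [a0 b0 c0 d0] : [/\ 0 <= quat_re p ^+ 2, 0 <= quat_i p ^+ 2,
    0 <= quat_j p ^+ 2 & 0 <= quat_k p ^+ 2] by rewrite !sqr_ge0.
by apply: quat_ext; apply/eqP; rewrite -sqrf_eq0; apply/eqP => /=; lra.
Qed.

(* Makes [`|q|] the Euclidean norm, and balls, neighbourhoods, limits and
   derivatives in the quaternions those of this norm. *)
HB.instance Definition _ :=
  Lmodule_isNormed.Build R (quaternion R)
    ler_norm_quatD norm_quatZ norm_quat0_eq0.

End QuaternionAlgebra.

Definition imaginary_units (R : realType) : set (quaternion R) :=
  [set I | I ^+ 2 = - 1].
Arguments imaginary_units : clear implicits.

Definition slice_point (R : realType) (I : quaternion R) (x y : R) :
  quaternion R := x%:A + y *: I.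

(* A function on [Omega] is encoded as a total function whose values outside
   [Omega] are irrelevant. This is sound since [Omega] is meant to be open:
   differentiability and partial derivatives at points of [Omega] then only
   depend on the values on [Omega]. *)
Definition cullen_regular (R : realType) (Omega : set (quaternion R))
    (f : quaternion R -> quaternion R) : Prop :=
  (forall q, Omega q -> differentiable f q) /\
  (forall I, imaginary_units R I -> forall x y : R,
    Omega (slice_point I x y) ->
    2^-1 *: (derive1 (fun u : R => f (slice_point I u y)) x
             + I * derive1 (fun v : R => f (slice_point I x v)) y) = 0).

(* Main.v *)
Require Import Defs.
From HB Require Import structures.
From mathcomp Require Import all_boot all_order all_algebra.
From mathcomp Require Import all_classical all_reals all_analysis.
From mathcomp Require Import ring lra.

Import Order.TTheory GRing.Theory Num.Theory.
Import numFieldNormedType.Exports.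

(** The minimum modulus principle is the maximum modulus principle for the regular
   reciprocal of [f].

   On every slice [f (x + J y) = al + J be], where [al] and [be] depend on [(x, y)]
   only ([representation_formula]). On a slice [L_J] put
   [h = conj al + J conj be], the regular conjugate of [f], and
   [s = (|al|^2 - |be|^2) + 2 <al, be> J], its symmetrization. Both are holomorphic
   on [L_J], and [h * f (x + T y) = s] with [T = h^-1 J h] ([conj_mul_stem]): the
   reciprocal [G = s^-1 h] has at [x + J y] the modulus [1 / |f|], taken at the
   turned point [x + T y] of the same sphere. Let [p = x0 + I y0] be a local minimum
   point with [w = f p] nonzero, and choose [J = w^-1 I w]; then the point of [L_J]
   over [(x0, y0)] is turned onto [p], and nearby points are turned to points near
   [p] ([turned_point_near]). So [|G|] has a local maximum there and [G] is locally
   a constant [c] ([strong_maximum]). By the identity theorem [h = s c] on the whole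
   disc; comparing conjugate points, [s] times [|c|^2] is idempotent, hence locally
   [1], so [h] is locally constant, hence constant, and [be = 0], [al] is constant.

   This needs [s] not to vanish over [(x0, y0)], that is, [f] to have no zero on the
   sphere of [p]. On that sphere [|f|^2] comes from a quadratic form in the
   quaternion that turns [I], so that a local minimum is a global one
   ([quadratic_form_ge0], [symmetrization_neq0]).

   Regularity asks for differentiability at each point, without continuity of the
   derivative, so the complex analysis starts from Goursat's bisection. It is run on
   finite midpoint sums of a closed form ([goursat]); in exponential polar
   coordinates it shows that the means over circles of a holomorphic function
   converge to the value at the centre ([circle_sum_cvg]). Hence the strong and the
   weak maximum principles, and the identity theorem by repeated division by
   [z - a] ([schwarz_vanishing]). A holomorphic function that vanishes on the real
   axis remains holomorphic when cut off to [0] on one side, so it vanishes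
   ([vanishing_real_axis]); this gives the representation formula. *)

Set Implicit Arguments.
Unset Strict Implicit.
Unset Printing Implicit Defensive.

Local Open Scope classical_set_scope.
Local Open Scope ring_scope.

(** * Norm, conjugation and imaginary units *)

Section QuaternionNorm.
Context {R : realType}.
Implicit Types (p q I X : quaternion R) (x y t : R).

Definition conjq q := Quat (quat_re q) (- quat_i q) (- quat_j q) (- quat_k q).

Definition dotq p q := quat_re p * quat_re q + quat_i p * quat_i q
  + quat_j p * quat_j q + quat_k p * quat_k q.

Definition invq q : quaternion R := (`|q| ^+ 2)^-1 *: conjq q.

Lemma sqr_normqE q :
  `|q| ^+ 2 = quat_re q ^+ 2 + quat_i q ^+ 2 + quat_j q ^+ 2 + quat_k q ^+ 2.
Proof. exact: (sqr_sqrtr (norm_quat_arg_ge0 q)). Qed.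

Lemma sqr_normq q : `|q| ^+ 2 = dotq q q.
Proof. by rewrite sqr_normqE /dotq !expr2. Qed.

Lemma normqM p q : `|p * q| = `|p| * `|q|.
Proof.
apply/eqP; rewrite -(eqrXn2 (n := 2)) ?mulr_ge0 // exprMn !sqr_normqE.
by case: p q => [a b c d] [a' b' c' d'] /=; apply/eqP; ring.
Qed.

Lemma normq1 : `|1 : quaternion R| = 1.
Proof.
apply/eqP; rewrite -(eqrXn2 (n := 2)) // sqr_normqE /=; apply/eqP; ring.
Qed.

Lemma conjqK : involutive conjq.
Proof. by case=> [????]; apply: quat_ext => /=; ring. Qed.

Lemma conjqD : {morph conjq : p q / p + q}.
Proof. by move=> p q; apply: quat_ext => /=; ring. Qed.

Lemma conjqN : {morph conjq : p / - p}.
Proof. by move=> p; apply: quat_ext. Qed.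

Lemma conjqZ x q : conjq (x *: q) = x *: conjq q.
Proof. by apply: quat_ext => /=; ring. Qed.

Lemma norm_conjq q : `|conjq q| = `|q|.
Proof.
by apply/eqP; rewrite -(eqrXn2 (n := 2)) // !sqr_normqE /= !sqrrN.
Qed.

Lemma mulq_conj q : q * conjq q = (`|q| ^+ 2)%:A.
Proof. by rewrite sqr_normqE; case: q => [????]; apply: quat_ext => /=; ring. Qed.

Lemma mulVq q : q != 0 -> invq q * q = 1.
Proof.
move=> q0; rewrite /invq -{3}(conjqK q) -scalerAl mulq_conj norm_conjq scalerA.
by rewrite mulVf ?scale1r // sqrf_eq0 normr_eq0.
Qed.

Lemma mulqV q : q != 0 -> q * invq q = 1.
Proof.
move=> q0; rewrite /invq -scalerAr mulq_conj scalerA.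
by rewrite mulVf ?scale1r // sqrf_eq0 normr_eq0.
Qed.

Lemma normqB_sqr p q : `|p - q| ^+ 2 = `|p| ^+ 2 - 2 * dotq p q + `|q| ^+ 2.
Proof. by rewrite !sqr_normqE /dotq /=; ring. Qed.

Lemma normqD_sqr p q : `|p + q| ^+ 2 = `|p| ^+ 2 + 2 * dotq p q + `|q| ^+ 2.
Proof. by rewrite !sqr_normqE /dotq /=; ring. Qed.

Lemma dotq_le p q : dotq p q <= `|p| * `|q|.
Proof.
have := ler_normD p q; rewrite -(ler_sqr (_ : _ \is Num.nneg)) ?nnegrE ?addr_ge0 //.
by rewrite normqD_sqr; nra.
Qed.

Lemma unit_imagP I : imaginary_units R I ->
  quat_re I = 0 /\ quat_i I ^+ 2 + quat_j I ^+ 2 + quat_k I ^+ 2 = 1.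
Proof.
rewrite /imaginary_units /=; case: I => a b c d.
move=> I2.
have e1 : a * a - b * b - c * c - d * d = - 1 by exact: (congr1 (@quat_re R) I2).
have : a * b + b * a + c * d - d * c = - 0 by exact: (congr1 (@quat_i R) I2).
have : a * c - b * d + c * a + d * b = - 0 by exact: (congr1 (@quat_j R) I2).
have : a * d + b * c - c * b + d * a = - 0 by exact: (congr1 (@quat_k R) I2).
rewrite /=; move=> e4 e3 e2.
have a0 : a = 0.
  apply/eqP/negP => /negP a0.
  have b0 : b = 0 by apply: (mulfI a0); lra.
  have c0 : c = 0 by apply: (mulfI a0); lra.
  have d0 : d = 0 by apply: (mulfI a0); lra.
  by move: e1; rewrite b0 c0 d0; nra.
by split=> //; move: e1; rewrite a0; nra.
Qed.

Lemma norm_imag_unit I : imaginary_units R I -> `|I| = 1.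
Proof.
case/unit_imagP=> a0 bcd; apply/eqP; rewrite -(eqrXn2 (n := 2)) //.
by rewrite sqr_normqE a0 expr0n /= add0r bcd expr1n.
Qed.

Lemma imag_unit_sqr I : imaginary_units R I -> I * I = - 1.
Proof. by rewrite /imaginary_units /= expr2. Qed.

Lemma imag_unitMK I X : imaginary_units R I -> I * (I * X) = - X.
Proof. by move=> SI; rewrite mulrA imag_unit_sqr // mulN1r. Qed.

Lemma imag_unit_conj I X : X != 0 -> imaginary_units R I ->
  imaginary_units R (invq X * I * X).
Proof.
move=> X0 SI; rewrite /imaginary_units /= expr2 -!mulrA (mulrA X (invq X)).
by rewrite mulqV // mul1r imag_unitMK // mulrN mulVq.
Qed.

Lemma sqr_norm_slice_point I x y : imaginary_units R I ->
  `|slice_point I x y| ^+ 2 = x ^+ 2 + y ^+ 2.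
Proof.
case/unit_imagP=> a0 bcd; rewrite sqr_normqE /slice_point /= a0.
have -> : y ^+ 2 = y ^+ 2 * (quat_i I ^+ 2 + quat_j I ^+ 2 + quat_k I ^+ 2).
  by rewrite bcd mulr1.
by ring.
Qed.

Lemma slice_pointE I x y : slice_point I x y = x%:A + y *: I.
Proof. by []. Qed.

Lemma slice_pointM I x y x' y' : imaginary_units R I ->
  slice_point I x y * slice_point I x' y' =
  slice_point I (x * x' - y * y') (x * y' + y * x').
Proof.
move=> SI; rewrite !slice_pointE mulrDl !mulrDr -!scalerAl -!scalerAr !mul1r !mulr1.
rewrite (imag_unit_sqr SI) !scalerA scalerN scalerBl scalerDl.
by rewrite [X in _ + X]addrC addrACA.
Qed.

Lemma slice_pointV I x y : imaginary_units R I -> x ^+ 2 + y ^+ 2 != 0 ->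
  slice_point I x y *
  slice_point I (x / (x ^+ 2 + y ^+ 2)) (- y / (x ^+ 2 + y ^+ 2)) = 1.
Proof.
move=> SI n0; rewrite slice_pointM // slice_pointE.
have -> : x * (- y / (x ^+ 2 + y ^+ 2)) + y * (x / (x ^+ 2 + y ^+ 2)) = 0 by field.
have -> : x * (x / (x ^+ 2 + y ^+ 2)) - y * (- y / (x ^+ 2 + y ^+ 2)) = 1 by field.
by rewrite scale1r scale0r addr0.
Qed.

(** The values [p + I q] and [p - I q] at two conjugate points of a slice
   determine [p] and [q]. *)
Lemma slice_stem_inj I p q p' q' : imaginary_units R I ->
  p + I * q = p' + I * q' -> p - I * q = p' - I * q' -> p = p' /\ q = q'.
Proof.
move=> SI e1 e2.
have half (u v : quaternion R) : u + u = v + v -> u = v.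
  move=> uv; have : 2^-1 *: (u + u) = 2^-1 *: (v + v) by rewrite uv.
  rewrite !scalerDr -!scalerDl (_ : 2^-1 + 2^-1 = 1) ?scale1r //.
  by field.
have pp : p = p'.
  apply: half; have := congr2 +%R e1 e2; rewrite addrACA subrr addr0 => ->.
  by rewrite addrACA subrr addr0.
split=> //; move: e1; rewrite pp => /addrI /(congr1 (fun v : quaternion R => I * v)).
by rewrite !imag_unitMK // => /oppr_inj.
Qed.

(** The unit [i] serves for real points, where no unit is preferred. *)
Lemma slice_point_exists q :
  exists I x y, imaginary_units R I /\ q = slice_point I x y.
Proof.
case: q => a b c d.
pose n := Num.sqrt (b ^+ 2 + c ^+ 2 + d ^+ 2).
have n2 : n ^+ 2 = b ^+ 2 + c ^+ 2 + d ^+ 2.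
  by rewrite sqr_sqrtr // !addr_ge0 // sqr_ge0.
have [n0|n0] := eqVneq n 0.
  have [b0 [c0 d0]] : b ^+ 2 = 0 /\ c ^+ 2 = 0 /\ d ^+ 2 = 0.
    move: n2; rewrite n0 expr0n /= => n2.
    by move: (sqr_ge0 b) (sqr_ge0 c) (sqr_ge0 d); lra.
  exists (Quat 0 1 0 0), a, 0; split.
    by apply: quat_ext => /=; ring.
  move/eqP: b0; move/eqP: c0; move/eqP: d0; rewrite !sqrf_eq0.
  by move=> /eqP-> /eqP-> /eqP->; apply: quat_ext => /=; ring.
exists (Quat 0 (b / n) (c / n) (d / n)), a, n; split.
  rewrite /imaginary_units /= expr2; apply: quat_ext => /=; last 3 first.
  - by ring.
  - by ring.
  - by ring.
  have -> : 0 * 0 - b / n * (b / n) - c / n * (c / n) - d / n * (d / n) =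
     - ((b ^+ 2 + c ^+ 2 + d ^+ 2) / n ^+ 2) by field.
  by rewrite -n2 divff // sqrf_eq0.
by apply: quat_ext => /=; field.
Qed.

End QuaternionNorm.

(** * Differentials in two real variables and slice holomorphy *)

Section PairDifferential.
Context {R : realType}.

(** [A] and [B] are the partial derivatives of [F] at [z]; the predicate asks for
   the full differential, so that chain and product rules are available without
   any continuity of the partial derivatives. *)
Definition pdiff (V : normedModType R) (F : R * R -> V) (z : R * R) (A B : V) :=
  is_diff z F (fun h : R * R => h.1 *: A + h.2 *: B).

Lemma pair_linear_continuous (V : normedModType R) (A B : V) :
  continuous (fun h : R * R => h.1 *: A + h.2 *: B).
Proof.
move=> z; apply: cvgD.
  by apply: cvgZr_tmp; exact: cvg_fst.
by apply: cvgZr_tmp; exact: cvg_snd.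
Qed.

Section PairLinear.
Variables (V : normedModType R) (A B : V).
Definition pair_linear (h : R * R) := h.1 *: A + h.2 *: B.
Lemma pair_linear_linear : linear pair_linear.
Proof.
move=> k [a b] [c d]; rewrite /pair_linear /= !scalerDl scalerDr !scalerA.
by rewrite addrACA.
Qed.
HB.instance Definition _ := GRing.isLinear.Build R (R * R)%type V _ pair_linear
  pair_linear_linear.
End PairLinear.

(** Epsilon form of the definition, for limit arguments at a single point. *)
Lemma pdiffP (V : normedModType R) (F : R * R -> V) z A B :
  pdiff F z A B <-> forall e, 0 < e -> \forall h \near (0 : R * R),
    `|F (z + h) - F z - (h.1 *: A + h.2 *: B)| <= e * `|h|.
Proof.
split=> [dF e e0|H].
  have [dz dE] := dF.
  have /eqaddoP/(_ _ e0) := diff_locally dz.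
  apply: filterS => h; rewrite /= dE.
  by rewrite !fctE/= opprD addrA [h + z]addrC.
have lc := @pair_linear_continuous V A B.
have E : 'd F z = pair_linear A B :> (R * R -> V).
  apply: diff_unique; first exact: lc.
  apply/eqaddoP => e e0; have := H _ e0.
  by apply: filterS => h hH; rewrite /= !fctE/= opprD addrA [h + z]addrC.
constructor; last by rewrite E.
apply/diff_locallyP; split; rewrite E; first exact: lc.
apply/eqaddoP => e e0; have := H _ e0.
by apply: filterS => h hH; rewrite /= !fctE/= opprD addrA [h + z]addrC.
Qed.

Lemma pdiff_continuous (V : normedModType R) (F : R * R -> V) z A B :
  pdiff F z A B -> {for z, continuous F}.
Proof. by case=> dF _; exact: differentiable_continuous. Qed.

Lemma pdiff_near (V : normedModType R) (F G : R * R -> V) z A B :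
  (\forall w \near z, F w = G w) -> pdiff F z A B -> pdiff G z A B.
Proof.
move=> FG /pdiffP H; apply/pdiffP => e e0.
have Fz := nbhs_singleton FG.
have /nbhs0P FG0 := FG.
near=> h.
have <- : F (z + h) = G (z + h) by near: h; exact: FG0.
by rewrite -Fz; near: h; exact: H.
Unshelve. all: by end_near. Qed.

Lemma pdiff_cst (V : normedModType R) (c : V) z : pdiff (fun=> c) z 0 0.
Proof.
apply/pdiffP => e e0; near=> h.
by rewrite !scaler0 addr0 !subrr normr0 mulr_ge0 // ltW.
Unshelve. all: by end_near. Qed.

Lemma pdiffD (V : normedModType R) (F G : R * R -> V) z A B C D :
  pdiff F z A B -> pdiff G z C D ->
  pdiff (fun w => F w + G w) z (A + C) (B + D).
Proof.
move=> dF dG; apply: (is_diff_eq (is_diffD dF dG)); apply/funext => h /=.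
by rewrite !fctE /= !scalerDr addrACA.
Qed.

Lemma pdiff_lin (V W : normedModType R) (L : V -> W) k (F : R * R -> V) z A B :
  linear L -> (forall v, `|L v| <= k * `|v|) ->
  pdiff F z A B -> pdiff (fun w => L (F w)) z (L A) (L B).
Proof.
move=> Llin Lk /pdiffP H; apply/pdiffP => e e0.
have LB u v : L (u - v) = L u - L v.
  by rewrite -scaleN1r addrC Llin scaleN1r addrC.
have L2 a b u v : L (a *: u + b *: v) = a *: L u + b *: L v.
  rewrite Llin -[b *: v]subr0 LB.
  have -> : L 0 = 0 by rewrite -(subrr 0) LB subrr.
  by rewrite subr0 -[b *: v]addr0 Llin -(subrr 0) LB subrr addr0.
have k0 : 0 < `|k| + 1 by rewrite ltr_wpDl.
have ek : 0 < e / (`|k| + 1) by rewrite divr_gt0.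
apply: filterS (H _ ek) => h hH.
rewrite -L2 -!LB; apply: le_trans (Lk _) _.
apply: (@le_trans _ _ ((`|k| + 1) * (e / (`|k| + 1) * `|h|))); last first.
  by rewrite mulrA [(_ + 1) * _]mulrC divfK // gt_eqF.
apply: (@le_trans _ _ ((`|k| + 1) * `|F (z + h) - F z - (h.1 *: A + h.2 *: B)|)).
  by apply: ler_wpM2r => //; apply: le_trans (ler_norm k) _; rewrite lerDl.
by apply: ler_wpM2l => //; exact: ltW.
Qed.

Lemma pdiff_comp (V : normedModType R) (F : R * R -> V) (u v : R * R -> R) z
    A B ux uy vx vy :
  pdiff u z ux uy -> pdiff v z vx vy -> pdiff F (u z, v z) A B ->
  pdiff (fun w => F (u w, v w)) z (ux *: A + vx *: B) (uy *: A + vy *: B).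
Proof.
move=> du dv dF.
have dp := is_diff_pair du dv.
apply: (is_diff_eq (is_diff_comp dp dF)); apply/funext => h /=.
rewrite !scalerDl !scalerDr !scalerA addrACA.
by congr (_ + _ + _); rewrite mulrC.
Qed.

Lemma pdiff_fst z : pdiff (fun w : R * R => w.1) z (1 : R) 0.
Proof.
apply/pdiffP => e e0; near=> h.
rewrite /= !scaler0 addr0 /GRing.scale /= mulr1 (addrC z.1) addrK subrr normr0.
by rewrite mulr_ge0 // ltW.
Unshelve. all: by end_near. Qed.

Lemma pdiff_snd z : pdiff (fun w : R * R => w.2) z (0 : R) 1.
Proof.
apply/pdiffP => e e0; near=> h.
rewrite /= !scaler0 add0r /GRing.scale /= mulr1 (addrC z.2) addrK subrr normr0.
by rewrite mulr_ge0 // ltW.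
Unshelve. all: by end_near. Qed.

Lemma pdiff_fun1 (g : R -> R) (u : R * R -> R) z g' ux uy :
  is_derive (u z) 1 g g' -> pdiff u z ux uy ->
  pdiff (fun w => g (u w)) z (g' * ux) (g' * uy).
Proof.
move=> dg du.
have dgz : derivable g (u z) 1 by exact: ex_derive.
have dgd : differentiable g (u z) by exact/derivable1_diffP.
have iz := differentiableP dgd.
apply: (is_diff_eq (is_diff_comp du iz)); apply/funext => h /=.
rewrite diff1E // derive1E (@derive_val _ _ _ _ _ _ _ dg).
by rewrite /GRing.scale /=; ring.
Qed.

Lemma scale_bilinear (V : normedModType R) :
  bilinear_for (GRing.Scale.Law.clone _ _ *:%R _) (GRing.Scale.Law.clone _ _ *:%R _)
    (@GRing.scale R V).
Proof.
split=> [u' a x y|u a x y] /=.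
  by rewrite scalerDl scalerA.
by rewrite scalerDr !scalerA mulrC.
Qed.

HB.instance Definition _ (V : normedModType R) :=
  bilinear_isBilinear.Build R R V V _ _ (@GRing.scale R V) (scale_bilinear V).

Lemma pdiffZ (V : normedModType R) (u : R * R -> R) (F : R * R -> V) z A B a b :
  pdiff u z a b -> pdiff F z A B ->
  pdiff (fun w => u w *: F w) z (a *: F z + u z *: A) (b *: F z + u z *: B).
Proof.
move=> du dF.
have sc : continuous (fun p : R * V => p.1 *: p.2) by exact: scale_continuous.
have ds : is_diff (u z, F z) (fun p : R * V => p.1 *: p.2)
    (fun q => u z *: q.2 + q.1 *: F z).
  constructor; first exact: (@differentiable_bilin _ _ _ _ (@GRing.scale R V)).
  by rewrite (@diff_bilin _ _ _ _ (@GRing.scale R V)).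
have dp := is_diff_pair du dF.
apply: (is_diff_eq (is_diff_comp dp ds)); apply/funext => h /=.
rewrite !scalerDr !scalerDl !scalerA addrC addrACA /GRing.scale /=.
by congr (_ + _ + (_ + _)); congr (_ *: _); rewrite mulrC.
Qed.

Lemma pdiffM (u v : R * R -> R) z a b c d :
  pdiff u z a b -> pdiff v z c d ->
  pdiff (fun w => u w * v w) z (a * v z + u z * c) (b * v z + u z * d).
Proof. by move=> du dv; exact: pdiffZ. Qed.

Lemma pdiffN (V : normedModType R) (F : R * R -> V) z A B :
  pdiff F z A B -> pdiff (fun w => - F w) z (- A) (- B).
Proof.
move=> dF; apply: (is_diff_eq (is_diffN dF)); apply/funext => h /=.
by rewrite !fctE /= opprD !scalerN.
Qed.

Lemma pdiffB (V : normedModType R) (F G : R * R -> V) z A B C D :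
  pdiff F z A B -> pdiff G z C D ->
  pdiff (fun w => F w - G w) z (A - C) (B - D).
Proof. by move=> dF /pdiffN; exact: pdiffD. Qed.

Lemma pdiffV (u : R * R -> R) z a b : u z != 0 ->
  pdiff u z a b ->
  pdiff (fun w => (u w)^-1) z (- a / u z ^+ 2) (- b / u z ^+ 2).
Proof.
move=> u0 du.
have dV : is_derive (u z) 1 (fun x : R => x^-1) (- (u z) ^- 2).
  apply: is_derive_eq; first by apply: is_deriveV.
  by rewrite /GRing.scale /= mulr1.
have := pdiff_fun1 dV du.
by rewrite !mulNr ![_ ^- 2 * _]mulrC.
Qed.

End PairDifferential.

Section SliceHolomorphic.
Context {R : realType}.
Local Notation H := (quaternion R).

(** The pair [(x, y)] stands for [x + J y]; taking [J * A] for the derivative in [y]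
   is the Cauchy-Riemann equation of the slice [L_J]. *)
Definition hol (J : H) (F : R * R -> H) (z : R * R) :=
  exists A, pdiff F z A (J * A).

Lemma pdiff_mull (c : H) (F : R * R -> H) z A B :
  pdiff F z A B -> pdiff (fun w => c * F w) z (c * A) (c * B).
Proof.
apply: (@pdiff_lin _ H H ( *%R c) `|c|) => [k u v|v]; last by rewrite normqM.
by rewrite mulrDr scalerAr.
Qed.

Lemma pdiff_conjq (F : R * R -> H) z A B :
  pdiff F z A B -> pdiff (fun w => conjq (F w)) z (conjq A) (conjq B).
Proof.
apply: (@pdiff_lin _ H H conjq 1) => [k u v|v]; last by rewrite norm_conjq mul1r.
by rewrite conjqD conjqZ.
Qed.

Lemma pdiff_coord (F : R * R -> H) z A B : pdiff F z A B ->
  [/\ pdiff (fun w => quat_re (F w)) z (quat_re A) (quat_re B),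
    pdiff (fun w => quat_i (F w)) z (quat_i A) (quat_i B),
    pdiff (fun w => quat_j (F w)) z (quat_j A) (quat_j B) &
    pdiff (fun w => quat_k (F w)) z (quat_k A) (quat_k B)].
Proof.
move=> dF.
have coord_le (a : R) (v : H) : a ^+ 2 <= `|v| ^+ 2 -> `|a| <= 1 * `|v|.
  by move=> av; rewrite mul1r -ler_sqr ?nnegrE // real_normK ?num_real.
have sq := (fun x : R => sqr_ge0 x).
split; [apply: (@pdiff_lin _ H R (@quat_re R) 1) dF
  | apply: (@pdiff_lin _ H R (@quat_i R) 1) dF
  | apply: (@pdiff_lin _ H R (@quat_j R) 1) dF
  | apply: (@pdiff_lin _ H R (@quat_k R) 1) dF] => // v; apply: coord_le;
  rewrite sqr_normqE;
  move: (sq (quat_re v)) (sq (quat_i v)) (sq (quat_j v)) (sq (quat_k v)); lra.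
Qed.

Lemma pdiff_dotq (F G : R * R -> H) z A B C D :
  pdiff F z A B -> pdiff G z C D ->
  pdiff (fun w => dotq (F w) (G w)) z (dotq A (G z) + dotq (F z) C)
    (dotq B (G z) + dotq (F z) D).
Proof.
case/pdiff_coord=> F0 F1 F2 F3; case/pdiff_coord=> G0 G1 G2 G3.
have := pdiffD (pdiffD (pdiffD (pdiffM F0 G0) (pdiffM F1 G1)) (pdiffM F2 G2))
  (pdiffM F3 G3).
have E (a b c d e f g h : R) :
  a + b + (c + d) + (e + f) + (g + h) = (a + c + e + g) + (b + d + f + h) by ring.
by rewrite !E.
Qed.

Lemma holB J F G z : hol J F z -> hol J G z -> hol J (fun w => F w - G w) z.
Proof.
by move=> [A dA] [B dB]; exists (A - B); rewrite mulrBr; exact: pdiffB.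
Qed.

Lemma hol_cst J c z : hol J (fun=> c) z.
Proof. by exists 0; rewrite mulr0; exact: pdiff_cst. Qed.

Lemma hol_near J F G z : (\forall w \near z, F w = G w) -> hol J F z -> hol J G z.
Proof. by move=> FG [A dA]; exists A; exact: pdiff_near dA. Qed.

Lemma hol_continuous J F z : hol J F z -> {for z, continuous F}.
Proof. by case=> A /pdiff_continuous. Qed.

(** A scalar holomorphic function is a pair [(u, v)] satisfying the
   Cauchy-Riemann equations; it acts on the left through [u + v J]. *)
Lemma hol_slice_scale J (u v : R * R -> R) F z a b : imaginary_units R J ->
  pdiff u z a (- b) -> pdiff v z b a -> hol J F z ->
  hol J (fun w => slice_point J (u w) (v w) * F w) z.
Proof.
move=> SJ du dv [A dF].
exists (slice_point J a b * F z + slice_point J (u z) (v z) * A).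
have := pdiffD (pdiffZ du dF) (pdiffZ dv (pdiff_mull J dF)).
have E (x y : R) (q : H) : slice_point J x y * q = x *: q + y *: (J * q).
  by rewrite slice_pointE mulrDl -!scalerAl mul1r.
under [fun w => slice_point J _ _ * _]funext do rewrite E.
congr (pdiff _ _ _ _); rewrite !E.
  by rewrite addrACA.
rewrite !mulrDr -!scalerAr !(imag_unitMK _ SJ) !scalerN !scaleNr.
rewrite addrACA [- _ + _]addrC; congr (_ + _).
Qed.

Lemma inv_cauchy_riemann (u v : R * R -> R) z a b :
  u z ^+ 2 + v z ^+ 2 != 0 -> pdiff u z a (- b) -> pdiff v z b a ->
  exists c d, pdiff (fun w => u w / (u w ^+ 2 + v w ^+ 2)) z c (- d) /\
    pdiff (fun w => - v w / (u w ^+ 2 + v w ^+ 2)) z d c.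
Proof.
move=> n0 du dv.
have dn := pdiffV n0 (pdiffD (pdiffM du du) (pdiffM dv dv)).
have d1 := pdiffM du dn; have d2 := pdiffM (pdiffN dv) dn.
pose n := u z ^+ 2 + v z ^+ 2.
exists (- (a * (u z ^+ 2 - v z ^+ 2) + 2 * b * u z * v z) / n ^+ 2).
exists (- (b * (u z ^+ 2 - v z ^+ 2) - 2 * a * u z * v z) / n ^+ 2).
split.
  by move: d1; congr (pdiff _ _ _ _); rewrite /n; field.
by move: d2; congr (pdiff _ _ _ _); rewrite /n; field.
Qed.

End SliceHolomorphic.

(** * Goursat's theorem for midpoint sums *)

Section MidpointSums.
Context {R : realType} {V : normedModType R}.
Implicit Types (g : R -> V) (P Q : R * R -> V) (a b h k c : R) (n : nat).

(** Halving the interval lowers the depth by one, so contour sums are exactly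
   additive under quartering; and midpoints, rather than endpoints, make every
   depth exact on affine functions. With both exact, Goursat's argument applies
   to these sums as they stand. *)
Fixpoint midsum g n a h : V :=
  if n is n'.+1 then midsum g n' a (h / 2) + midsum g n' (a + h / 2) (h / 2)
  else h *: g (a + h / 2).

Lemma midsumD g1 g2 n a h :
  midsum (fun x => g1 x + g2 x) n a h = midsum g1 n a h + midsum g2 n a h.
Proof.
elim: n a h => [|n IH] a h /=; first by rewrite scalerDr.
by rewrite !IH addrACA.
Qed.

Lemma norm_midsum_le g n a h M : 0 <= h ->
  (forall x, a <= x <= a + h -> `|g x| <= M) -> `|midsum g n a h| <= h * M.
Proof.
elim: n a h => [|n IH] a h h0 gM /=.
  by rewrite normrZ ger0_norm // ler_wpM2l // gM //; lra.
apply: le_trans (ler_normD _ _) _.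
have -> : h * M = h / 2 * M + h / 2 * M by field.
have h20 : 0 <= h / 2 by lra.
by apply: lerD; apply: IH => // x xh; apply: gM; lra.
Qed.

Lemma midsum_affine (p q : V) n a h :
  midsum (fun x => p + x *: q) n a h = h *: (p + (a + h / 2) *: q).
Proof.
elim: n a h => [|n IH] a h //=; rewrite !IH !scalerDr !scalerA addrACA -!scalerDl.
by congr (_ *: _ + _ *: _); rewrite /GRing.scale /=; field.
Qed.

Lemma eq_midsum g1 g2 n a h : g1 =1 g2 -> midsum g1 n a h = midsum g2 n a h.
Proof. by move=> /funext ->. Qed.

Definition contour P Q n a b h k : V :=
  midsum (fun x => P (x, b)) n a h + midsum (fun y => Q (a + h, y)) n b k
  - midsum (fun x => P (x, b + k)) n a h - midsum (fun y => Q (a, y)) n b k.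

Lemma contour_quarter P Q n a b h k :
  contour P Q n.+1 a b h k =
  contour P Q n a b (h / 2) (k / 2) + contour P Q n (a + h / 2) b (h / 2) (k / 2)
  + (contour P Q n a (b + k / 2) (h / 2) (k / 2)
     + contour P Q n (a + h / 2) (b + k / 2) (h / 2) (k / 2)).
Proof.
rewrite /contour /=.
have -> : a + h / 2 + h / 2 = a + h by field.
have -> : b + k / 2 + k / 2 = b + k by field.
rewrite !opprD !addrA.
by rewrite [RHS](ACl (1*5*6*14*11*15*4*12*2*8*9*3*13*7*10*16))/= !addrK.
Qed.

Lemma contourD P1 P2 Q1 Q2 n a b h k :
  contour (fun z => P1 z + P2 z) (fun z => Q1 z + Q2 z) n a b h k =
  contour P1 Q1 n a b h k + contour P2 Q2 n a b h k.
Proof.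
rewrite /contour !midsumD !opprD.
by rewrite !addrA [RHS](ACl (1*5*2*6*3*7*4*8)).
Qed.

(** The coefficient [c] occurs twice: it is the common value of the mixed
   derivatives [P_y] and [Q_x] of a closed form [P dx + Q dy]. *)
Lemma contour_affine (p pa q c d : V) n a b h k :
  contour (fun z => p + z.1 *: pa + z.2 *: c) (fun z => q + z.1 *: c + z.2 *: d)
    n a b h k = 0.
Proof.
rewrite /contour /=.
have E (y : R) : (fun x => p + x *: pa + y *: c) =1 (fun x => p + y *: c + x *: pa).
  by move=> x; rewrite addrAC.
rewrite !(eq_midsum _ _ _ (E _)) !midsum_affine.
have cancel3 (u v w x : V) : u + v + w - (u + x + w) = v - x.
  by rewrite opprD addrACA subrr addr0 opprD addrACA subrr add0r.
rewrite [X in X - _]addrAC -[LHS]addrA -!scalerBr !cancel3 -!scalerBl !scalerA -scalerDl.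
by rewrite (_ : _ + _ = 0) ?scale0r //; ring.
Qed.

Lemma norm_contour_le P Q n a b h k M : 0 <= h -> 0 <= k ->
  (forall z, a <= z.1 <= a + h -> b <= z.2 <= b + k ->
    `|P z| <= M /\ `|Q z| <= M) ->
  `|contour P Q n a b h k| <= 2 * (h + k) * M.
Proof.
move=> h0 k0 PQ.
have -> : 2 * (h + k) * M = h * M + k * M + h * M + k * M by ring.
apply: le_trans (ler_normB _ _) _; apply: lerD; last first.
  by apply: norm_midsum_le => // x xh; case: (PQ (a, x)) => //=; lra.
apply: le_trans (ler_normB _ _) _; apply: lerD; last first.
  by apply: norm_midsum_le => // x xh; case: (PQ (x, b + k)) => //=; lra.
apply: le_trans (ler_normD _ _) _; apply: lerD; apply: norm_midsum_le => // x xh.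
  by case: (PQ (x, b)) => //=; lra.
by case: (PQ (a + h, x)) => //=; lra.
Qed.

End MidpointSums.

Section Goursat.
Context {R : realType} {V : normedModType R}.
Variables (P Q : R * R -> V).
Implicit Types (a b h k c : R) (n : nat) (w : R * R).

(** The quarter with the largest sum may vary with the depth, so a large sum is
   required at infinitely many depths: one of the quarters then inherits it. *)
Definition exceeds c w h k := forall N, exists2 n, (N <= n)%N &
  c < `|contour P Q n w.1 w.2 h k|.

(** Otherwise all four quarters are eventually small, and by additivity so is the
   rectangle. *)
Lemma exceeds_quarter c w h k : 0 <= h -> 0 <= k -> exceeds c w h k ->
  exists w', [/\ exceeds (c / 4) w' (h / 2) (k / 2),
    w.1 <= w'.1 <= w.1 + h / 2 & w.2 <= w'.2 <= w.2 + k / 2].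
Proof.
move=> h0 k0 ex; apply: contrapT => no.
have small w' : w.1 <= w'.1 <= w.1 + h / 2 -> w.2 <= w'.2 <= w.2 + k / 2 ->
    exists N, forall n, (N <= n)%N ->
      `|contour P Q n w'.1 w'.2 (h / 2) (k / 2)| <= c / 4.
  move=> w1 w2; apply: contrapT => big; apply: no; exists w'; split=> // N.
  apply: contrapT => big2; apply: big; exists N => n Nn.
  by rewrite leNgt; apply/negP => lt; apply: big2; exists n.
have [||N1 H1] := small w; [lra|lra|].
have [||N2 H2] := small (w.1 + h / 2, w.2); [move=> /=; lra|move=> /=; lra|].
have [||N3 H3] := small (w.1, w.2 + k / 2); [move=> /=; lra|move=> /=; lra|].
have [||N4 H4] := small (w.1 + h / 2, w.2 + k / 2);
  [move=> /=; lra|move=> /=; lra|].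
have [[//|n] nN] := ex (maxn (maxn N1 N2) (maxn N3 N4)).+1.
move: nN; rewrite ltnS !geq_max => /andP[/andP[n1 n2] /andP[n3 n4]].
rewrite contour_quarter ltNge => /negP; apply.
have -> : c = c / 4 + c / 4 + (c / 4 + c / 4) by field.
apply: le_trans (ler_normD _ _) _; apply: lerD.
  apply: le_trans (ler_normD _ _) _; apply: lerD; [exact: H1|exact: H2].
apply: le_trans (ler_normD _ _) _; apply: lerD; [exact: H3|exact: H4].
Qed.

Lemma div_exp2_lt (x d : R) : 0 < d -> exists j, x / 2 ^+ j < d.
Proof.
move=> d0; exists (Num.bound `|x / d|).
rewrite ltr_pdivrMr ?exprn_gt0 // mulrC -ltr_pdivrMr //.
apply: (@lt_trans _ _ (Num.bound `|x / d|)%:R).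
  by apply: le_lt_trans (ler_norm _) (archi_boundP (normr_ge0 _)).
by rewrite -natrX ltr_nat ltn_expl.
Qed.

Lemma exceeds_point c a b h k : 0 <= h -> 0 <= k -> exceeds c (a, b) h k ->
  exists z, [/\ a <= z.1 <= a + h, b <= z.2 <= b + k & forall j, exists w,
    [/\ exceeds (c / 4 ^+ j) w (h / 2 ^+ j) (k / 2 ^+ j),
      w.1 <= z.1 <= w.1 + h / 2 ^+ j & w.2 <= z.2 <= w.2 + k / 2 ^+ j]].
Proof.
move=> h0 k0 ex.
have p0 j : 0 < (2 : R) ^+ j by rewrite exprn_gt0.
pose good j w := exceeds (c / 4 ^+ j) w (h / 2 ^+ j) (k / 2 ^+ j).
have step (jw : nat * (R * R)) : exists w', good jw.1 jw.2 ->
    [/\ good jw.1.+1 w', jw.2.1 <= w'.1 <= jw.2.1 + h / 2 ^+ jw.1 / 2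
      & jw.2.2 <= w'.2 <= jw.2.2 + k / 2 ^+ jw.1 / 2].
  have [g|ng] := pselect (good jw.1 jw.2); last by exists (a, b).
  have [w' H] := exceeds_quarter (divr_ge0 h0 (ltW (p0 jw.1)))
    (divr_ge0 k0 (ltW (p0 jw.1))) g.
  exists w' => _; move: H; rewrite /good !exprS.
  by rewrite ![(2 : R) * _]mulrC ![(4 : R) * _]mulrC !invfM !mulrA.
have [F HF] := choice step.
pose s := fix s j := if j is j'.+1 then F (j', s j') else (a, b).
have gs j : good j (s j).
  elim: j => [|j IH]; first by rewrite /good !expr0 !divr1.
  by case: (HF (j, s j) IH).
have mono j : [/\ (s j).1 <= (s j.+1).1,
    (s j.+1).1 + h / 2 ^+ j.+1 <= (s j).1 + h / 2 ^+ j,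
    (s j).2 <= (s j.+1).2 & (s j.+1).2 + k / 2 ^+ j.+1 <= (s j).2 + k / 2 ^+ j].
  have [_ /= /andP[l1 u1] /andP[l2 u2]] := HF (j, s j) (gs j).
  rewrite exprS [2 * _]mulrC !invfM !mulrA; split=> //; lra.
have nested i j : (i <= j)%N -> [/\ (s i).1 <= (s j).1,
    (s j).1 + h / 2 ^+ j <= (s i).1 + h / 2 ^+ i,
    (s i).2 <= (s j).2 & (s j).2 + k / 2 ^+ j <= (s i).2 + k / 2 ^+ i].
  elim: j => [|j IH]; first by rewrite leqn0 => /eqP->.
  rewrite leq_eqVlt => /orP[/eqP->//|]; rewrite ltnS => /IH[A B C D].
  by have [A' B' C' D'] := mono j; split; lra.
have hj j : 0 <= h / 2 ^+ j by rewrite divr_ge0 // ltW.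
have kj j : 0 <= k / 2 ^+ j by rewrite divr_ge0 // ltW.
have cross i j : (s i).1 <= (s j).1 + h / 2 ^+ j /\
    (s i).2 <= (s j).2 + k / 2 ^+ j.
  have [ij|/ltnW ji] := leqP i j.
    by have [A B C D] := nested _ _ ij; move: (hj j) (kj j); split; lra.
  by have [A B C D] := nested _ _ ji; move: (hj i) (kj i); split; lra.
pose S1 := range (fun j => (s j).1); pose S2 := range (fun j => (s j).2).
have S1n j : S1 (s j).1 by exists j.
have S2n j : S2 (s j).2 by exists j.
have hS1 : has_sup S1.
  by split; [exists (s 0%N).1|exists (a + h) => _ [j _ <-]; case: (cross j 0%N) => /=;
    rewrite expr0 !divr1].
have hS2 : has_sup S2.
  by split; [exists (s 0%N).2|exists (b + k) => _ [j _ <-]; case: (cross j 0%N) => /=;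
    rewrite expr0 !divr1].
have in1 j : (s j).1 <= sup S1 <= (s j).1 + h / 2 ^+ j.
  rewrite sup_upper_bound //=; apply: sup_le_ub; first by case: hS1.
  by move=> _ [i _ <-]; case: (cross i j).
have in2 j : (s j).2 <= sup S2 <= (s j).2 + k / 2 ^+ j.
  rewrite sup_upper_bound //=; apply: sup_le_ub; first by case: hS2.
  by move=> _ [i _ <-]; case: (cross i j).
exists (sup S1, sup S2); split=> /=.
- by move: (in1 0%N); rewrite expr0 divr1.
- by move: (in2 0%N); rewrite expr0 divr1.
by move=> j; exists (s j); split; [exact: gs|exact: in1|exact: in2].
Qed.

(** In the nested rectangles around the point given by [exceeds_point] the form is
   affine up to an error [o(diameter)], and closed affine forms have zero contour
   sums; so the sums over these rectangles are [o(area)], against the lower bound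
   [c / 4 ^ j]. *)
Theorem goursat a b h k : 0 < h -> 0 < k ->
  (forall z, a <= z.1 <= a + h -> b <= z.2 <= b + k ->
    exists A C D, pdiff P z A C /\ pdiff Q z C D) ->
  forall c, 0 < c -> exists N, forall n, (N <= n)%N ->
    `|contour P Q n a b h k| <= c.
Proof.
move=> h0 k0 dPQ c c0; apply: contrapT => no.
have ex : exceeds c (a, b) h k.
  move=> N; apply: contrapT => big; apply: no; exists N => n Nn.
  by rewrite leNgt; apply/negP => lt; apply: big; exists n.
have [z [z1 z2 zj]] := exceeds_point (ltW h0) (ltW k0) ex.
have [A [C [D [/pdiffP dP /pdiffP dQ]]]] := dPQ z z1 z2.
(* a rectangle of sides [h / 2 ^ j], [k / 2 ^ j] has sum at most
   [2 e ((h + k) / 2 ^ j) ^ 2 = c / 4 ^ j] *)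
pose e := c / (2 * (h + k) ^+ 2).
have e0 : 0 < e by rewrite divr_gt0 // mulr_gt0 // exprn_gt0 // addr_gt0.
have /nbhs_norm0P[d /= d0 Hd] : \forall v \near (0 : R * R),
    `|P (z + v) - P z - (v.1 *: A + v.2 *: C)| <= e * `|v| /\
    `|Q (z + v) - Q z - (v.1 *: C + v.2 *: D)| <= e * `|v|.
  exact: (filterI (dP _ e0) (dQ _ e0)).
have [j hkj] := div_exp2_lt (h + k) d0.
have [w [exw w1 w2]] := zj j.
have [n _] := exw 0%N.
pose P0 (y : R * R) := (P z - z.1 *: A - z.2 *: C) + y.1 *: A + y.2 *: C.
pose Q0 (y : R * R) := (Q z - z.1 *: C - z.2 *: D) + y.1 *: C + y.2 *: D.
have -> : contour P Q n w.1 w.2 (h / 2 ^+ j) (k / 2 ^+ j) =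
  contour (fun y => P y - P0 y) (fun y => Q y - Q0 y) n w.1 w.2
    (h / 2 ^+ j) (k / 2 ^+ j).
  rewrite -[RHS]addr0.
  rewrite -[in RHS](contour_affine (P z - z.1 *: A - z.2 *: C) A
    (Q z - z.1 *: C - z.2 *: D) C D n w.1 w.2 (h / 2 ^+ j) (k / 2 ^+ j)).
  rewrite -contourD; congr contour; apply/funext => y; rewrite /= subrK //.
set hj := h / 2 ^+ j; set kj := k / 2 ^+ j.
have p0 : 0 < (2 : R) ^+ j by rewrite exprn_gt0.
have hj0 : 0 < hj by rewrite divr_gt0.
have kj0 : 0 < kj by rewrite divr_gt0.
have hkE : (h + k) / 2 ^+ j = hj + kj by rewrite mulrDl.
rewrite ltNge => /negP; apply.
apply: (@le_trans _ _ (2 * (hj + kj) * (e * (hj + kj)))).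
  apply: norm_contour_le; [exact: ltW|exact: ltW|] => y y1 y2.
  have yz : `|y - z| <= hj + kj.
    rewrite prod_normE /= ge_max !ler_norml; apply/andP; split; lra.
  have [|HP HQ] := Hd (y - z); first by rewrite /= (le_lt_trans yz) // -hkE.
  have bound : e * `|y - z| <= e * (hj + kj) by rewrite ler_wpM2l // ltW.
  have E (f p B1 B2 : V) : f - (p - z.1 *: B1 - z.2 *: B2 + y.1 *: B1 + y.2 *: B2) =
      f - p - ((y - z).1 *: B1 + (y - z).2 *: B2).
    rewrite -[RHS]addrA -opprD !scalerBl !addrA; congr (_ - _).
    by rewrite [RHS](ACl (1*3*5*2*4)).
  move: HP HQ; rewrite [z + _]addrC subrK -!E => HP HQ.
  by split; [apply: le_trans HP _|apply: le_trans HQ _].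
rewrite le_eqVlt; apply/orP; left; apply/eqP.
have -> : 4 = (2 : R) ^+ 2 by ring.
by rewrite -exprM mulnC exprM -hkE /e; field; rewrite !gt_eqF ?addr_gt0.
Qed.

End Goursat.

(** * Circle means and the strong maximum principle *)

Section MidsumOrder.
Context {R : realType}.
Implicit Types (g : R -> R) (a h : R) (n : nat).

Lemma le_midsum g1 g2 n a h : 0 <= h ->
  (forall x, a <= x <= a + h -> g1 x <= g2 x) ->
  midsum g1 n a h <= midsum g2 n a h.
Proof.
elim: n a h => [|n IH] a h h0 le12 /=; first by rewrite ler_wpM2l // le12 //; lra.
by apply: lerD; apply: IH; try lra; move=> x xh; apply: le12; lra.
Qed.

Lemma midsum_cst (V : normedModType R) (v : V) n a h :
  midsum (fun=> v) n a h = h *: v.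
Proof.
elim: n a h => [//|n IH] a h /=; rewrite !IH -scalerDl.
by congr (_ *: _); field.
Qed.

(** The dyadic cells of a midpoint sum refine those of the coarser ones, so the
   sum over a cell around a given point is a part of every finer sum. *)
Lemma midsum_cell g a h x j : 0 <= h ->
  (forall y, a <= y <= a + h -> 0 <= g y) -> a <= x <= a + h ->
  exists a', [/\ a <= a' /\ a' + h / 2 ^+ j <= a + h, a' <= x <= a' + h / 2 ^+ j
    & forall n, midsum g n a' (h / 2 ^+ j) <= midsum g (n + j) a h].
Proof.
elim: j a h => [|j IH] a h h0 g0 xh.
  by exists a; rewrite expr0 divr1; split=> // n; rewrite addn0.
have E : h / 2 ^+ j.+1 = h / 2 / 2 ^+ j by rewrite exprS invfM mulrA.
have pos n a1 : a <= a1 -> a1 + h / 2 <= a + h -> 0 <= midsum g n a1 (h / 2).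
  move=> l u; rewrite -(scaler0 R (h / 2)) -(midsum_cst (0 : R) n a1).
  by apply: le_midsum => [|y yh]; [lra|apply: g0; lra].
have [xl|xr] := leP x (a + h / 2).
  have [|||a' [[A B] C D]] := IH a (h / 2); [lra|by move=> y yh; apply: g0; lra|lra|].
  exists a'; rewrite E; split=> //; first by split; lra.
  move=> n; rewrite addnS /=; apply: le_trans (D n) _.
  by rewrite lerDl pos //; lra.
have [|||a' [[A B] C D]] := IH (a + h / 2) (h / 2);
  [lra|by move=> y yh; apply: g0; lra|lra|].
exists a'; rewrite E; split=> //; first by split; lra.
move=> n; rewrite addnS /=; apply: le_trans (D n) _.
by rewrite lerDr pos //; lra.
Qed.

End MidsumOrder.

Section Polar.
Context {R : realType}.
Local Notation H := (quaternion R).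
Implicit Types (J : H) (F : R * R -> H) (c z w : R * R) (t : R) (n : nat).

(** The norm of [R * R] is the maximum norm; the discs needed here are Euclidean,
   and this encoding inherits the triangle inequality from quaternions. *)
Definition edist z w : R := `|Quat (z.1 - w.1) (z.2 - w.2) 0 0|.

Definition disc c (rho : R) z := edist z c < rho.

Lemma edist_sqr z w : edist z w ^+ 2 = (z.1 - w.1) ^+ 2 + (z.2 - w.2) ^+ 2.
Proof. by rewrite /edist sqr_normqE /=; ring. Qed.

Lemma edist_ge0 z w : 0 <= edist z w.
Proof. exact: normr_ge0. Qed.

Lemma edistC z w : edist z w = edist w z.
Proof.
apply/eqP; rewrite -(eqrXn2 (n := 2)) ?edist_ge0 // !edist_sqr; apply/eqP; ring.
Qed.

Lemma edist_triangle w z v : edist z v <= edist z w + edist w v.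
Proof.
apply: le_trans (ler_normD _ _); rewrite le_eqVlt; apply/orP; left; apply/eqP.
by congr (`|_|); apply: quat_ext => /=; ring.
Qed.

Lemma edist_lin z w s : edist (z.1 + s * (w.1 - z.1), z.2 + s * (w.2 - z.2)) z
  = `|s| * edist w z.
Proof.
apply/eqP; rewrite -(eqrXn2 (n := 2)) ?mulr_ge0 ?edist_ge0 // exprMn.
by rewrite !edist_sqr real_normK ?num_real //=; apply/eqP; ring.
Qed.

Lemma edistxx z : edist z z = 0.
Proof. by apply/eqP; rewrite normr_eq0 !subrr. Qed.

Lemma edist_eq0 z w : (edist z w == 0) = (z == w).
Proof.
rewrite normr_eq0; apply/eqP/eqP => [|->]; last by rewrite !subrr.
case: z w => [z1 z2] [w1 w2] /= [] /eqP + /eqP.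
by rewrite !subr_eq0 => /eqP-> /eqP->.
Qed.

(** The point [c + exp (z.1 + J z.2)]. The exponential is holomorphic, so
   Goursat's theorem on rectangles of the [z]-plane speaks about annuli. *)
Definition polar c z : R * R := (c.1 + expR z.1 * cos z.2, c.2 + expR z.1 * sin z.2).

Lemma polar_dist c z : edist (polar c z) c = expR z.1.
Proof.
apply/eqP; rewrite -(eqrXn2 (n := 2)) ?edist_ge0 ?expR_ge0 // edist_sqr; apply/eqP.
rewrite /= ![c.1 + _]addrC ![c.2 + _]addrC !addrK !exprMn -mulrDr cos2Dsin2.
by rewrite mulr1.
Qed.

Lemma polar_exists c w : w != c -> exists t x, 0 <= x <= 0 + 2 * pi /\ w = polar c (t, x).
Proof.
move=> wc.
pose a := w.1 - c.1; pose b := w.2 - c.2.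
have ab0 : 0 < a ^+ 2 + b ^+ 2.
  rewrite lt_neqAle addr_ge0 ?sqr_ge0 // andbT eq_sym paddr_eq0 ?sqr_ge0 //.
  rewrite !sqrf_eq0 !subr_eq0; apply: contra wc.
  by case: w c {a b} => [w1 w2] [c1 c2] /= /andP[/eqP-> /eqP->].
pose r := Num.sqrt (a ^+ 2 + b ^+ 2).
have r0 : 0 < r by rewrite sqrtr_gt0.
have r2 : r ^+ 2 = a ^+ 2 + b ^+ 2 by rewrite sqr_sqrtr // ltW.
have ar : -1 <= a / r <= 1.
  rewrite -ler_norml normrM normfV (gtr0_norm r0) ler_pdivrMr // mul1r.
  rewrite -ler_sqr ?nnegrE ?(ltW r0) // real_normK ?num_real // r2.
  by rewrite lerDl sqr_ge0.
have ca : cos (acos (a / r)) = a / r by rewrite acosK.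
have sa : sin (acos (a / r)) = `|b / r|.
  rewrite sin_acos // -sqrtr_sqr; congr Num.sqrt.
  by rewrite !exprMn exprVn r2; field; rewrite gt_eqF.
have pi0 := pi_gt0 R.
have ca0 : 0 <= acos (a / r) by exact: acos_ge0.
have cap : acos (a / r) <= pi by exact: acos_lepi.
have wE : w = (c.1 + r * (a / r), c.2 + r * (b / r)).
  by rewrite ![r * _]mulrC !divfK ?gt_eqF // !subrKC; case: (w).
exists (ln r); have [b0|b0] := leP 0 (b / r).
  exists (acos (a / r)); split; first by lra.
  by rewrite wE /polar /= lnK ?posrE // ca sa ger0_norm.
exists (2 * pi - acos (a / r)); split; first by lra.
rewrite wE /polar /= lnK ?posrE // [_ - _]addrC mulr_natl cosD2pi sinD2pi.
by rewrite cosN sinN ca sa ltr0_norm // opprK.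
Qed.

Lemma hol_polar J F c z : imaginary_units R J -> hol J F (polar c z) ->
  hol J (fun w => F (polar c w)) z.
Proof.
move=> SJ [A dF].
have de := pdiff_fun1 (is_derive_expR z.1) (pdiff_fst z).
have dc := pdiff_fun1 (is_derive_cos z.2) (pdiff_snd z).
have ds := pdiff_fun1 (is_derive_sin z.2) (pdiff_snd z).
have du := pdiffD (pdiff_cst c.1 z) (pdiffM de dc).
have dv := pdiffD (pdiff_cst c.2 z) (pdiffM de ds).
exists (expR z.1 * cos z.2 *: A + expR z.1 * sin z.2 *: (J * A)).
have := pdiff_comp du dv dF.
congr (pdiff _ _ _ _).
  by congr (_ *: _ + _ *: _); ring.
rewrite mulrDr -!scalerAr (imag_unitMK _ SJ) scalerN -scaleNr [RHS]addrC.
by congr (_ *: _ + _ *: _); rewrite /GRing.scale /=; ring.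
Qed.

Definition circle_sum F c t n := midsum (fun x => F (polar c (t, x))) n 0 (2 * pi).

Lemma polar_2pi c t : polar c (t, 0 + 2 * pi) = polar c (t, 0).
Proof. by rewrite /polar /= add0r mulr_natl cos2pi sin2pi cos0 sin0. Qed.

Lemma midsum_mull J (g : R -> H) n a h :
  midsum (fun x => J * g x) n a h = J * midsum g n a h.
Proof.
elim: n a h => [|n IH] a h /=; first by rewrite scalerAr.
by rewrite !IH mulrDr.
Qed.

(** The two horizontal sides of the rectangle [t0, t1] x [0, 2 pi] have the same
   image under [polar c], and cancel; there remain the two circles. *)
Lemma circle_sum_radius J F c t0 t1 e : imaginary_units R J -> t0 < t1 -> 0 < e ->
  (forall z, t0 <= z.1 <= t1 -> hol J F (polar c z)) ->
  exists N, forall n, (N <= n)%N ->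
    `|circle_sum F c t1 n - circle_sum F c t0 n| <= e.
Proof.
move=> SJ t01 e0 hF.
have t010 : 0 < t1 - t0 by rewrite subr_gt0.
have pi0 : 0 < 2 * pi :> R by rewrite mulr_gt0 // pi_gt0.
have [|N HN] := goursat (P := F \o polar c) (Q := fun w => J * F (polar c w))
    (a := t0) (b := 0) t010 pi0 _ e0.
  move=> z z1 _; have [||A dA] := @hol_polar J F c z; [by []|apply: hF; lra|].
  by exists A, (J * A), (J * (J * A)); split=> //; exact: pdiff_mull.
exists N => n /HN; rewrite /contour /=.
rewrite (subrKC t0) !midsum_mull.
have -> : (fun x : R => F (polar c (x, 0 + 2 * pi))) = (fun x => F (polar c (x, 0))).
  by apply/funext => x; rewrite polar_2pi.
rewrite [X in X - _]addrAC subrr add0r -mulrBr normqM (norm_imag_unit SJ) mul1r.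
by [].
Qed.

Lemma disc_nbhs c z rho : disc c rho z -> \forall w \near z, disc c rho w.
Proof.
rewrite /disc => zc; have rho0 : 0 < rho by apply: le_lt_trans zc; exact: edist_ge0.
have : {for z, continuous (fun w : R * R => (w.1 - c.1) ^+ 2 + (w.2 - c.2) ^+ 2)}.
  have d1 := pdiffB (pdiff_fst z) (pdiff_cst c.1 z).
  have d2 := pdiffB (pdiff_snd z) (pdiff_cst c.2 z).
  exact: pdiff_continuous (pdiffD (pdiffM d1 d1) (pdiffM d2 d2)).
move: zc; rewrite -ltr_sqr ?nnegrE ?edist_ge0 ?(ltW rho0) // edist_sqr => zc.
move=> cont; near=> w.
rewrite -ltr_sqr ?nnegrE ?edist_ge0 ?(ltW rho0) // edist_sqr.
by near: w; exact: cont _ (lt_nbhsl zc).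
Unshelve. all: by end_near. Qed.

Lemma disc_center c rho : 0 < rho -> disc c rho c.
Proof. by rewrite /disc edistxx. Qed.

Lemma polar_disc c z rho : expR z.1 < rho -> disc c rho (polar c z).
Proof. by rewrite /disc polar_dist. Qed.

Lemma nbhs_disc z (A : set (R * R)) : nbhs z A ->
  exists2 rho, 0 < rho & forall w, disc z rho w -> A w.
Proof.
move=> /nbhs_normP[d /= d0 Hd]; exists d => // w zw; apply: Hd => /=.
apply: le_lt_trans zw; rewrite prod_normE /= ge_max.
have le_dist x : x ^+ 2 <= edist w z ^+ 2 -> `|x| <= edist w z.
  by move=> xd; rewrite -ler_sqr ?nnegrE ?edist_ge0 // real_normK ?num_real.
rewrite (distrC z.1) (distrC z.2).
by apply/andP; split; apply: le_dist; rewrite edist_sqr ?lerDl ?lerDr sqr_ge0.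
Qed.

(** The mean value property: shrink the radius until [F] is close to [F c] on the
   whole circle. *)
Lemma circle_sum_cvg J F c rho t e : imaginary_units R J -> 0 < e ->
  expR t < rho -> (forall z, disc c rho z -> hol J F z) ->
  exists N, forall n, (N <= n)%N ->
    `|circle_sum F c t n - (2 * pi) *: F c| <= e.
Proof.
move=> SJ e0 trho hF.
have pi0 : 0 < 2 * pi :> R by rewrite mulr_gt0 // pi_gt0.
have rho0 : 0 < rho by apply: lt_trans trho; exact: expR_gt0.
have hc : hol J F c by apply: hF; exact: disc_center.
have e20 : 0 < e / 2 / (2 * pi) by rewrite !divr_gt0.
have /cvgrPdist_le/(_ _ e20) := hol_continuous hc.
move=> /nbhs_disc[d d0 Hd].
have [t0 t0t t0d] : exists2 t0, t0 < t & expR t0 < d.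
  exists (Num.min (t - 1) (ln d - 1)); first by rewrite gt_min; apply/orP; left; lra.
  rewrite -[X in _ < X]lnK ?posrE // ltr_expR gt_min; apply/orP; right; lra.
have [|N HN] := @circle_sum_radius J F c t0 t (e / 2) SJ t0t (divr_gt0 e0 (ltr0Sn _ 1)).
  move=> z zt; apply: hF; apply: polar_disc.
  by apply: le_lt_trans trho; rewrite ler_expR; lra.
exists N => n /HN le1.
rewrite -[circle_sum F c t n](subrK (circle_sum F c t0 n)) -addrA.
apply: le_trans (ler_normD _ _) _; rewrite (splitr e); apply: lerD => //.
rewrite -(midsum_cst (F c) n 0) /circle_sum -[X in _ + X]mulN1r -midsum_mull -midsumD.
have -> : e / 2 = (2 * pi) * (e / 2 / (2 * pi)) by rewrite [RHS]mulrC divfK // gt_eqF.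
apply: norm_midsum_le; first exact: ltW.
by move=> x _; rewrite mulN1r distrC; apply: Hd; exact: polar_disc.
Qed.

Lemma dotqDl (p q r : H) : dotq (p + q) r = dotq p r + dotq q r.
Proof. by rewrite /dotq /=; ring. Qed.

Lemma dotqZl x (p q : H) : dotq (x *: p) q = x * dotq p q.
Proof. by rewrite /dotq /=; ring. Qed.

Lemma dotqBl (p q r : H) : dotq (p - q) r = dotq p r - dotq q r.
Proof. by rewrite /dotq /=; ring. Qed.

Lemma midsum_dotq (g : R -> H) q n a h :
  midsum (fun x => dotq (g x) q) n a h = dotq (midsum g n a h) q.
Proof.
elim: n a h => [|n IH] a h /=; first by rewrite dotqZl.
by rewrite !IH dotqDl.
Qed.

(** The defect [|F c|^2 - <F, F c>] is nonnegative where [|F| <= |F c|], and its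
   circle means tend to [0]; being continuous it vanishes, which is the equality
   case of Cauchy-Schwarz. *)
Lemma strong_maximum J F c rho w : imaginary_units R J ->
  (forall z, disc c rho z -> hol J F z) ->
  (forall z, disc c rho z -> `|F z| <= `|F c|) ->
  disc c rho w -> F w = F c.
Proof.
move=> SJ hF maxF cw.
have [->//|wc] := eqVneq w c.
have [t [x0 [x0I wE]]] := polar_exists wc.
have trho : expR t < rho by rewrite -(polar_dist c (t, x0)) -wE.
have pi0 : 0 < 2 * pi :> R by rewrite mulr_gt0 // pi_gt0.
pose g x := `|F c| ^+ 2 - dotq (F (polar c (t, x))) (F c).
have g0 x : 0 <= g x.
  rewrite subr_ge0; apply: le_trans (dotq_le _ _) _; rewrite expr2 ler_wpM2r //.
  by apply: maxF; exact: polar_disc.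
have gx0 : g x0 = 0.
  apply/eqP; rewrite eq_le g0 andbT leNgt; apply/negP => gpos.
  pose M := `|F c| + 1.
  have M0 : 0 < M by rewrite ltr_wpDl.
  have e0 : 0 < g x0 / 2 / M by rewrite !divr_gt0.
  have hx : hol J (fun z => F (polar c z)) (t, x0).
    by apply: hol_polar => //; apply: hF; exact: polar_disc.
  have /cvgrPdist_le/(_ _ e0)/nbhs_normP[d /= d0 Hd] := hol_continuous hx.
  have near_x0 x : `|x0 - x| < d -> g x0 / 2 <= g x.
    move=> xd; have := Hd (t, x); rewrite /= prod_normE /= subrr normr0.
    rewrite gt_max d0 xd => /(_ erefl) Fd.
    have : dotq (F (polar c (t, x)) - F (polar c (t, x0))) (F c) <= g x0 / 2.
      apply: le_trans (dotq_le _ _) _; rewrite distrC.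
      apply: (@le_trans _ _ (g x0 / 2 / M * M)); last by rewrite divfK // gt_eqF.
      by apply: ler_pM => //; rewrite lerDl.
    by rewrite dotqBl /g; lra.
  have [j hj] := div_exp2_lt (2 * pi) d0.
  have [||a' [_ a'x cell]] := midsum_cell (g := g) (a := 0) (h := 2 * pi) (x := x0) j (ltW pi0) .
  - by move=> *; exact: g0.
  - by [].
  pose k : R := 2 * pi / 2 ^+ j.
  have k0 : 0 < k by rewrite divr_gt0 // exprn_gt0.
  have low n : k * (g x0 / 2) <= midsum g (n + j) 0 (2 * pi).
    apply: le_trans (cell n); 
    have <- : midsum (fun=> g x0 / 2 : R) n a' k = k * (g x0 / 2).
      by rewrite midsum_cst.
    apply: le_midsum; first exact: ltW.
    move=> x xI; apply: near_x0; apply: le_lt_trans hj.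
    by rewrite ler_norml; apply/andP; split; move: a'x xI; rewrite /k; lra.
  have kg0 : 0 < k * (g x0 / 2) / 2 / M by rewrite !divr_gt0 // mulr_gt0 ?divr_gt0.
  have [N HN] := circle_sum_cvg SJ kg0 trho hF.
  have := low N; rewrite leNgt => /negP; apply.
  have -> : midsum g (N + j) 0 (2 * pi) =
      dotq ((2 * pi) *: F c - circle_sum F c t (N + j)) (F c).
    rewrite dotqBl dotqZl -sqr_normq /circle_sum -midsum_dotq.
    rewrite -[X in _ - X]mul1r -mulNr.
    have -> : (2 * pi) * `|F c| ^+ 2 = midsum (fun=> `|F c| ^+ 2 : R) (N + j) 0 (2 * pi).
      by rewrite midsum_cst.
    have N1 (f : R -> R) n a h : - 1 * midsum f n a h = midsum (fun x => - 1 * f x) n a h.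
      elim: n a h => [|n IH] a h /=; first by rewrite /GRing.scale /=; ring.
      by rewrite mulrDr !IH.
    rewrite N1 -midsumD; apply: eq_midsum => x; rewrite /g; ring.
  apply: le_lt_trans (dotq_le _ _) _; rewrite distrC.
  have /HN le1 : (N <= N + j)%N by rewrite leq_addr.
  apply: (@le_lt_trans _ _ (k * (g x0 / 2) / 2 / M * M)).
    by apply: ler_pM => //; rewrite lerDl.
  rewrite divfK ?gt_eqF //; have : 0 < k * (g x0 / 2) by rewrite mulr_gt0 ?divr_gt0.
  lra.
have Fw : `|F w| <= `|F c| by apply: maxF.
apply/eqP; rewrite -subr_eq0 -normr_eq0 -sqrf_eq0 eq_le sqr_ge0 andbT.
rewrite normqB_sqr; move: gx0; rewrite /g -wE => gx0.
have : `|F w| ^+ 2 <= `|F c| ^+ 2 by rewrite ler_sqr ?nnegrE.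
lra.
Qed.

End Polar.

(** * Maximum principle and identity theorem *)

Section Identity.
Context {R : realType}.
Local Notation H := (quaternion R).
Implicit Types (J : H) (F : R * R -> H) (a c z w : R * R) (rho M : R).

Lemma compact_cdisc c rho : compact [set z : R * R | edist z c <= rho].
Proof.
have sub : [set z : R * R | edist z c <= rho] `<=`
    `[c.1 - rho, c.1 + rho]%classic `*` `[c.2 - rho, c.2 + rho]%classic.
  move=> z /= zc; have rho0 : 0 <= rho by apply: le_trans zc; exact: edist_ge0.
  have le_rho x : x ^+ 2 <= edist z c ^+ 2 -> - rho <= x <= rho.
    move=> xd; rewrite -ler_norml; apply: le_trans zc.
    by rewrite -ler_sqr ?nnegrE ?edist_ge0 // real_normK ?num_real.
  have := le_rho (z.1 - c.1); have := le_rho (z.2 - c.2).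
  rewrite edist_sqr lerDl lerDr !sqr_ge0 => /(_ erefl) z2 /(_ erefl) z1.
  by rewrite !in_itv /=; split; lra.
apply: subclosed_compact sub; last by apply: compact_setX; exact: segment_compact.
have -> : [set z : R * R | edist z c <= rho] = ~` [set z | rho < edist z c].
  by apply/seteqP; split=> z /=; rewrite leNgt => /negP.
apply: open_closedC; rewrite openE => z /= zc.
have /disc_nbhs : disc z (edist z c - rho) z by apply: disc_center; rewrite subr_gt0.
apply: filterS => w; rewrite /disc => zw /=.
by have := edist_triangle w z c; rewrite (edistC z w); lra.
Qed.

(** Around an interior maximum point [F] is constant on a disc that touches the
   circle, so by continuity the maximum is attained on the circle as well. *)
Lemma maximum_principle J F c rho M : imaginary_units R J -> 0 < rho ->
  (forall z, edist z c <= rho -> hol J F z) ->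
  (forall z, edist z c = rho -> `|F z| <= M) ->
  forall z, edist z c <= rho -> `|F z| <= M.
Proof.
move=> SJ rho0 hF FM.
have [||] := @compact_EVT_max _ R (fun z => `|F z|) _ _ (@compact_cdisc c rho).
- by exists c => /=; rewrite edistxx ltW.
- apply: continuous_in_subspaceT => z; rewrite inE /= => zc.
  by apply: cvg_norm; exact: hol_continuous (hF _ zc).
move=> m; rewrite inE /= => mc max_m z zc.
apply: (@le_trans _ _ `|F m|); first by apply: max_m; rewrite inE.
rewrite leNgt; apply/negP => Mm.
have mrho : edist m c < rho.
  rewrite lt_neqAle mc andbT; apply/eqP => E.
  by have := FM _ E; rewrite leNgt Mm.
pose d := rho - edist m c.
have d0 : 0 < d by rewrite subr_gt0.
have sub w : disc m d w -> edist w c <= rho.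
  by rewrite /disc /d => wm; have := edist_triangle m w c; lra.
have const w : disc m d w -> F w = F m.
  apply: (@strong_maximum _ J) => // w' /sub w'c; first exact: hF.
  by apply: max_m; rewrite inE.
have [w wc wm] : exists2 w, edist w c = rho & edist w m = d.
  have [mE|mc0] := eqVneq m c.
    have E : edist (c.1 + rho, c.2) c = rho.
      apply/eqP; rewrite -(eqrXn2 (n := 2)) ?edist_ge0 ?(ltW rho0) // edist_sqr /=.
      by apply/eqP; ring.
    by exists (c.1 + rho, c.2); [exact: E|rewrite /d mE E edistxx subr0].
  have mc1 : 0 < edist m c.
    by rewrite lt_neqAle edist_ge0 andbT eq_sym edist_eq0.
  exists (c.1 + rho / edist m c * (m.1 - c.1), c.2 + rho / edist m c * (m.2 - c.2)).
    by rewrite edist_lin ger0_norm ?divr_ge0 ?ltW // divfK // gt_eqF.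
  have -> : c.1 + rho / edist m c * (m.1 - c.1) =
      m.1 + (1 - rho / edist m c) * (c.1 - m.1) by ring.
  have -> : c.2 + rho / edist m c * (m.2 - c.2) =
      m.2 + (1 - rho / edist m c) * (c.2 - m.2) by ring.
  rewrite edist_lin ler0_norm; last first.
    by rewrite subr_le0 ler_pdivlMr // mul1r.
  by rewrite opprB (edistC c m) mulrBl divfK ?gt_eqF // mul1r.
have e0 : 0 < `|F m| - M by rewrite subr_gt0.
have hw : hol J F w by apply: hF; rewrite wc.
have /cvgrPdist_lt/(_ _ e0)/nbhs_disc[k k0 Hk] := hol_continuous hw.
pose s := Num.min (1 / 2) (k / (2 * d)).
have [s0 s1 sk] : [/\ 0 < s, s <= 1 / 2 & s <= k / (2 * d)].
  by rewrite lt_min !ge_min !lexx orbT divr_gt0 // divr_gt0 // mulr_gt0.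
pose v := (w.1 + s * (m.1 - w.1), w.2 + s * (m.2 - w.2)).
have vw : disc w k v.
  rewrite /disc edist_lin gtr0_norm // edistC wm.
  apply: (@le_lt_trans _ _ (k / (2 * d) * d)); first by rewrite ler_wpM2r // ltW.
  by rewrite (_ : k / (2 * d) * d = k / 2); [lra|field; rewrite gt_eqF].
have vm : disc m d v.
  rewrite /disc.
  have -> : v = (m.1 + (1 - s) * (w.1 - m.1), m.2 + (1 - s) * (w.2 - m.2)).
    by congr pair; ring.
  rewrite edist_lin wm ger0_norm; last lra.
  by rewrite mulrBl mul1r ltrBlDr ltrDl mulr_gt0.
have := Hk v vw; rewrite (const v vm) => lt1.
have := FM w wc; have := ler_normB (F w) (F w - F m).
by rewrite subKr; lra.
Qed.

(** Dividing by [z - a] keeps a function that vanishes near [a] holomorphic, and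
   by the maximum principle improves the bound by the factor [|z - a| / rho]. *)
Lemma schwarz_vanishing J F a rho M n : imaginary_units R J -> 0 < rho ->
  (forall z, edist z a <= rho -> hol J F z) -> (\forall z \near a, F z = 0) ->
  (forall z, edist z a <= rho -> `|F z| <= M) ->
  forall z, edist z a <= rho -> `|F z| <= M * (edist z a / rho) ^+ n.
Proof.
move=> SJ rho0.
elim: n F M => [|n IH] F M hF Fa FM z za; first by rewrite expr0 mulr1 FM.
pose u w := w.1 - a.1; pose v w := w.2 - a.2.
pose G w := slice_point J (u w / (u w ^+ 2 + v w ^+ 2))
                          (- v w / (u w ^+ 2 + v w ^+ 2)) * F w.
have uvE w : u w ^+ 2 + v w ^+ 2 = edist w a ^+ 2 by rewrite edist_sqr.
have normG w : edist w a * `|G w| = `|F w| \/ w = a.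
  have [->|wa] := eqVneq w a; [by right|left].
  have wa0 : 0 < edist w a by rewrite lt_neqAle edist_ge0 andbT eq_sym edist_eq0.
  rewrite /G normqM mulrA.
  suff -> : `|slice_point J (u w / (u w ^+ 2 + v w ^+ 2)) (- v w / (u w ^+ 2 + v w ^+ 2))|
    = (edist w a)^-1 by rewrite divff ?mul1r // gt_eqF.
  apply/eqP; rewrite -(eqrXn2 (n := 2)) ?invr_ge0 ?edist_ge0 //.
  rewrite sqr_norm_slice_point // !exprMn !exprVn sqrrN -mulrDl uvE.
  by apply/eqP; field; rewrite gt_eqF.
have Ga : \forall w \near a, G w = 0.
  by apply: filterS Fa => w; rewrite /G => ->; rewrite mulr0.
have hG w : edist w a <= rho -> hol J G w.
  move=> wr; have [->|wa] := eqVneq w a.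
    apply: (@hol_near _ _ (fun=> 0)); last exact: hol_cst.
    by apply: filterS Ga => w' ->.
  have uv0 : u w ^+ 2 + v w ^+ 2 != 0 by rewrite uvE sqrf_eq0 edist_eq0.
  have du : pdiff u w 1 (- 0).
    have := pdiffB (pdiff_fst w) (pdiff_cst a.1 w); by rewrite !subr0 oppr0.
  have dv : pdiff v w 0 1.
    have := pdiffB (pdiff_snd w) (pdiff_cst a.2 w); by rewrite !subr0.
  have [x [y [d1 d2]]] := inv_cauchy_riemann uv0 du dv.
  exact: hol_slice_scale d1 d2 (hF w wr).
have GM w : edist w a <= rho -> `|G w| <= M / rho.
  apply: (maximum_principle SJ rho0 hG) => w' wr.
  have [E|E] := normG w'; last by move: wr rho0; rewrite E edistxx => ->; rewrite ltxx.
  rewrite ler_pdivlMr // mulrC -wr E; apply: FM; by rewrite wr.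
have [E|->] := normG z; last first.
  by rewrite (nbhs_singleton Fa) normr0 edistxx mul0r exprS mul0r mulr0.
rewrite -E exprS.
have -> : M * (edist z a / rho * (edist z a / rho) ^+ n) =
  edist z a * (M / rho * (edist z a / rho) ^+ n) by ring.
by apply: ler_wpM2l; [exact: edist_ge0|exact: (IH G)].
Qed.

(** Letting the exponent of [schwarz_vanishing] go to infinity. *)
Lemma vanishing_disc J F a rho : imaginary_units R J ->
  (forall z, disc a rho z -> hol J F z) -> (\forall z \near a, F z = 0) ->
  forall z, disc a rho z -> F z = 0.
Proof.
move=> SJ hF Fa z; rewrite /disc => za.
pose r := (edist z a + rho) / 2.
have [zr rr] : edist z a < r /\ r < rho by rewrite /r; split; lra.
have r0 : 0 < r by apply: le_lt_trans zr; exact: edist_ge0.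
have hr w : edist w a <= r -> hol J F w.
  by move=> wr; apply: hF; exact: le_lt_trans rr.
have [||m _ max_m] := @compact_EVT_max _ R (fun z => `|F z|) _ _ (@compact_cdisc a r).
- by exists z; exact: ltW.
- apply: continuous_in_subspaceT => w; rewrite inE /= => wc.
  by apply: cvg_norm; exact: hol_continuous (hr _ wc).
have FM w : edist w a <= r -> `|F w| <= `|F m| by move=> wr; apply: max_m; rewrite inE.
have q0 : 0 <= edist z a / r by rewrite divr_ge0 ?edist_ge0 // ltW.
have q1 : `|edist z a / r| < 1.
  by rewrite (ger0_norm q0) ltr_pdivrMr // mul1r.
apply/eqP; rewrite -normr_le0; apply/ler_addgt0Pl => e e0; rewrite addr0.
have M0 : 0 < `|F m| + 1 by rewrite ltr_wpDl.
have eM : 0 < e / (`|F m| + 1) by rewrite divr_gt0.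
have /cvgr0Pnorm_lt/(_ _ eM)[n _ Hn] := cvg_expr q1.
have := Hn n (leqnn n); rewrite /= ger0_norm ?exprn_ge0 // => lt_n.
apply: le_trans (schwarz_vanishing n SJ r0 hr Fa FM (ltW zr)) _.
apply: (@le_trans _ _ ((`|F m| + 1) * (e / (`|F m| + 1)))).
  by apply: ler_pM; rewrite ?exprn_ge0 ?lerDl // ltW.
by rewrite mulrC divfK // gt_eqF.
Qed.

(** Discs centred on the segment from [a] to [c] carry the zeros to [c]. *)
Theorem identity_theorem J F c rho a : imaginary_units R J ->
  (forall z, disc c rho z -> hol J F z) -> disc c rho a ->
  (\forall z \near a, F z = 0) ->
  forall z, disc c rho z -> F z = 0.
Proof.
move=> SJ hF ac Fa; apply: (vanishing_disc SJ hF).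
have D0 : 0 < rho - edist a c by rewrite subr_gt0.
have [n nD] : exists n, edist a c / n.+1%:R < rho - edist a c.
  have [j] := div_exp2_lt (edist a c) D0.
  by move=> jD; exists (2 ^ j).-1; rewrite prednK ?expn_gt0 // natrX.
pose b k : R * R := (c.1 + (1 - k%:R / n.+1%:R) * (a.1 - c.1),
                     c.2 + (1 - k%:R / n.+1%:R) * (a.2 - c.2)).
have n0 : 0 < n.+1%:R :> R by [].
have bc k : (k <= n.+1)%N -> edist (b k) c <= edist a c.
  move=> kn; rewrite /b edist_lin ler_piMl ?edist_ge0 // ler_norml.
  have : k%:R / n.+1%:R <= 1 :> R by rewrite ler_pdivrMr // mul1r ler_nat.
  have : 0 <= k%:R / n.+1%:R :> R by rewrite divr_ge0.
  set q : R := k%:R / _ => q0 q1; apply/andP; split; lra.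
have bS k : edist (b k.+1) (b k) = edist a c / n.+1%:R.
  apply/eqP; rewrite -(eqrXn2 (n := 2)) ?divr_ge0 ?edist_ge0 // exprMn !edist_sqr /b /=.
  by rewrite -addn1 natrD; apply/eqP; field; rewrite gt_eqF.
have near_b k : (k <= n.+1)%N -> \forall z \near b k, F z = 0.
  elim: k => [|k IH] kn.
    suff -> : b 0%N = a by [].
    by rewrite /b mul0r subr0 !mul1r !subrKC; case: (a).
  have sub z : disc (b k) (rho - edist a c) z -> disc c rho z.
    rewrite /disc => zb; have := edist_triangle (b k) z c.
    by have := bc k (ltnW kn); lra.
  have F0 := vanishing_disc SJ (fun z zb => hF z (sub z zb)) (IH (ltnW kn)).
  have : disc (b k) (rho - edist a c) (b k.+1) by rewrite /disc bS.
  by move=> /disc_nbhs; apply: filterS => z; exact: F0.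
have := near_b n.+1 (leqnn _).
by rewrite /b divff ?gt_eqF // subrr !mul0r !addr0; case: (c).
Qed.

End Identity.

(** * The representation formula *)

Section RealAxis.
Context {R : realType}.
Local Notation H := (quaternion R).
Implicit Types (J : H) (F : R * R -> H) (z w : R * R) (rho : R).

Lemma snd_pos_nbhs (s : R) z : 0 < s * z.2 -> \forall w \near z, 0 < s * w.2.
Proof.
move=> sz.
have ds := pdiffM (pdiff_cst s z) (pdiff_snd z).
have := pdiff_continuous ds.
move=> cont; near=> w.
by near: w; exact: cont _ (lt_nbhsr sz).
Unshelve. all: by end_near. Qed.

(** Used on the real axis: zeros along a horizontal segment give a zero horizontal
   derivative. *)
Lemma pdiff_zero_row F z A B : pdiff F z A B -> F z = 0 ->
  (\forall h \near (0 : R), F (z.1 + h, z.2) = 0) -> A = 0.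
Proof.
move=> /pdiffP dF Fz F0.
apply/eqP; rewrite -normr_le0; apply/ler_addgt0Pl => e e0; rewrite addr0.
have /nbhs_norm0P[d /= d0 Hd] := dF _ e0.
have /nbhs_norm0P[k /= k0 Hk] := F0.
pose m := Num.min d k / 2.
have m0 : 0 < m by rewrite divr_gt0 // lt_min d0 k0.
have mm : m < Num.min d k by rewrite /m; move: m0; rewrite /m; lra.
move: mm; rewrite lt_min => /andP[md mk].
have nm : `|(m, 0) : R * R| = m.
  by rewrite prod_normE /= normr0 gtr0_norm // max_l // ltW.
have /= := Hd (m, 0); rewrite nm => /(_ md) /=.
have /= := Hk m; rewrite gtr0_norm // => /(_ mk).
have -> : z + (m, 0) = (z.1 + m, z.2) by case: (z) => a b; congr pair; rewrite /= addr0.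
move=> ->; rewrite Fz scale0r addr0 subrr sub0r normrN normrZ gtr0_norm //.
by rewrite mulrC ler_pM2r.
Qed.

(** On the real axis the derivative along the axis vanishes, hence by the
   Cauchy-Riemann equation the whole differential does. So cutting [F] off to
   [0] on one side of the axis leaves it holomorphic. *)
Lemma vanishing_half_disc J F rho s : imaginary_units R J -> 0 < rho -> s != 0 ->
  (forall z, disc 0 rho z -> hol J F z) ->
  (forall z, disc 0 rho z -> z.2 = 0 -> F z = 0) ->
  forall z, disc 0 rho z -> 0 < s * z.2 -> F z = 0.
Proof.
move=> SJ rho0 s0 hF F0.
pose E w := if 0 < s * w.2 then F w else 0.
suff E0 z : disc 0 rho z -> E z = 0.
  by move=> z /E0; rewrite /E => + sz; rewrite sz.
pose a : R * R := (0, - (rho / 2 / Num.sg s)).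
have sgs : s * (rho / 2 / Num.sg s) = `|s| * (rho / 2).
  rewrite {1}[s]numEsg; field; rewrite sgr_eq0 s0.
  by [].
have neg_near w : s * w.2 < 0 -> \forall w' \near w, E w' = 0.
  move=> sw; have : 0 < - s * w.2 by rewrite mulNr oppr_gt0.
  by move=> /snd_pos_nbhs; apply: filterS => w'; rewrite mulNr oppr_gt0 /E => /lt_gtF ->.
apply: (@identity_theorem _ J E 0 rho a) => //.
- move=> w wr; have [sw|sw|sw] := ltrgtP 0 (s * w.2).
  + apply: (@hol_near _ _ F); last exact: hF.
    by apply: filterS (snd_pos_nbhs sw) => w'; rewrite /E => ->.
  + apply: (@hol_near _ _ (fun=> 0)); last exact: hol_cst.
    by apply: filterS (neg_near _ sw) => w' ->.
  have w2 : w.2 = 0 by apply: (mulfI s0); rewrite -sw mulr0.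
  have Fw : F w = 0 by exact: F0.
  have [A dA] := hF w wr.
  have A0 : A = 0.
    apply: (pdiff_zero_row dA Fw).
    have nw := disc_nbhs wr.
    have /nbhs_norm0P[d /= d0 Hd] : \forall v \near (0 : R * R), disc 0 rho (w + v).
      by move/nbhs0P: nw.
    apply/nbhs_norm0P; exists d => // h /= hd; apply: F0 => //=.
    have /= := Hd (h, 0); rewrite prod_normE /= normr0 max_l // => /(_ hd).
    by congr disc; case: (w) => *; congr pair; rewrite /= addr0.
  exists 0; rewrite mulr0; apply/pdiffP => e e0.
  move: dA => /pdiffP/(_ _ e0); apply: filterS => h.
  have Ew : E w = 0 by rewrite /E -sw ltxx.
  rewrite A0 mulr0 !scaler0 addr0 Fw Ew !subr0 /E => le1.
  by case: ifP => // _; rewrite normr0 mulr_ge0 // ltW.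
- rewrite /disc -ltr_sqr ?nnegrE ?edist_ge0 ?(ltW rho0) // edist_sqr /= subrr subr0.
  rewrite expr0n /= add0r sqrrN exprMn exprVn.
  have -> : Num.sg s ^+ 2 = 1 by rewrite sqr_sg s0.
  rewrite invr1 mulr1; have := exprn_gt0 2 rho0; rewrite exprMn exprVn.
  by move=> r20; rewrite ltr_pdivrMr //; lra.
- apply: neg_near; rewrite /= mulrN sgs oppr_lt0 mulr_gt0 ?normr_gt0 // divr_gt0 //.
Qed.

Lemma vanishing_real_axis J F rho : imaginary_units R J ->
  (forall z, disc 0 rho z -> hol J F z) ->
  (forall z, disc 0 rho z -> z.2 = 0 -> F z = 0) ->
  forall z, disc 0 rho z -> F z = 0.
Proof.
move=> SJ hF F0 z zr.
have rho0 : 0 < rho by apply: le_lt_trans zr; exact: edist_ge0.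
have [z2|z2] := eqVneq z.2 0; first exact: F0.
by apply: (vanishing_half_disc SJ rho0 z2 hF F0 zr); rewrite -expr2 exprn_even_gt0.
Qed.

End RealAxis.

Section Slices.
Context {R : realType}.
Local Notation H := (quaternion R).
Implicit Types (I J : H) (F : R * R -> H) (z w : R * R) (x y rho : R).

Lemma pdiff_partial (F : R * R -> H) x y A B : pdiff F (x, y) A B ->
  derive1 (fun u => F (u, y)) x = A /\ derive1 (fun v => F (x, v)) y = B.
Proof.
move=> dF; split.
  have dp := is_diff_pair (is_diff_id x) (is_diff_cst y x).
  have [d1 d2] := is_diff_comp dp dF.
  rewrite derive1E deriveE // d2 /= scale1r.
  by rewrite [X in X *: B](_ : _ = 0) // scale0r addr0.
have dp := is_diff_pair (is_diff_cst x y) (is_diff_id y).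
have [d1 d2] := is_diff_comp dp dF.
rewrite derive1E deriveE // d2 /= scale1r.
by rewrite [X in X *: A](_ : _ = 0) // scale0r add0r.
Qed.

Lemma ball_slice_point I x y rho : imaginary_units R I ->
  ball (0 : H) rho (slice_point I x y) <-> disc 0 rho (x, y).
Proof.
move=> SI; rewrite -ball_normE /= sub0r normrN /disc.
suff -> : `|slice_point I x y| = edist (x, y) 0 by [].
apply/eqP; rewrite -(eqrXn2 (n := 2)) ?edist_ge0 // edist_sqr /= !subr0.
by rewrite sqr_norm_slice_point.
Qed.

Lemma regular_hol rho f I z : cullen_regular (ball (0 : H) rho) f ->
  imaginary_units R I -> disc 0 rho z ->
  hol I (fun w => f (slice_point I w.1 w.2)) z.
Proof.
case: z => x y [df cr] SI zr.
have bz : ball (0 : H) rho (slice_point I x y).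
  exact/ball_slice_point.
have sc : continuous (fun h : R * R => slice_point I h.1 h.2).
  exact: pair_linear_continuous.
have ds : is_diff (x, y) (fun h : R * R => slice_point I h.1 h.2) (pair_linear (1 : H) I).
  constructor; first exact: (@linear_differentiable _ _ _ (pair_linear (1 : H) I)).
  exact: (diff_lin _ (f := pair_linear (1 : H) I)).
have iF := differentiableP (df _ bz).
have iC := is_diff_comp ds iF.
set L := 'd f _ in iC.
have dF : pdiff (fun w => f (slice_point I w.1 w.2)) (x, y) (L 1) (L I).
  apply: (is_diff_eq iC); apply/funext => h /=.
  by rewrite /pair_linear linearD !linearZ.
exists (L 1); suff <- : L I = I * L 1 by [].
have := cr I SI x y bz.
have [/= -> ->] := pdiff_partial dF.
move=> /(congr1 (fun q => 2 *: q)); rewrite scalerA divff // scale1r scaler0.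
move=> /(congr1 (fun q => I * q)); rewrite mulrDr imag_unitMK // mulr0.
by move=> /eqP; rewrite subr_eq0 => /eqP.
Qed.

(** [al] and [be] are the components of a stem function [al + i be], and
   [fun z => al z + J be z] is the function that it induces on [L_J]. *)
Lemma stem_hol J (al be : R * R -> H) z A C : imaginary_units R J ->
  pdiff al z A (- C) -> pdiff be z C A ->
  hol J (fun w => al w + J * be w) z.
Proof.
move=> SJ dal dbe; exists (A + J * C).
have := pdiffD dal (pdiff_mull J dbe).
by congr (pdiff _ _ _ _); rewrite mulrDr imag_unitMK // addrC.
Qed.

Variables (rho : R) (f : H -> H) (I : H).
Hypotheses (f_regular : cullen_regular (ball (0 : H) rho) f)
  (SI : imaginary_units R I).

(** The stem function is read off on the two conjugate points [x + I y] and
   [x - I y] of one slice; [stem_im] is [- I (f (x + I y) - f (x - I y)) / 2]. *)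
Definition stem_re z : H :=
  2^-1 *: (f (slice_point I z.1 z.2) + f (slice_point I z.1 (- z.2))).

Definition stem_im z : H :=
  2^-1 *: (I * (f (slice_point I z.1 (- z.2)) - f (slice_point I z.1 z.2))).

Lemma stem_re_conj x y : stem_re (x, - y) = stem_re (x, y).
Proof. by rewrite /stem_re /= opprK addrC. Qed.

Lemma stem_im_conj x y : stem_im (x, - y) = - stem_im (x, y).
Proof. by rewrite /stem_im /= opprK -scalerN -mulrN opprB. Qed.

Lemma disc_conj (r x y : R) : disc 0 r (x, y) -> disc 0 r (x, - y).
Proof.
rewrite /disc; congr (_ < _).
by apply/eqP; rewrite -(eqrXn2 (n := 2)) ?edist_ge0 // !edist_sqr /= !subr0 sqrrN.
Qed.

Lemma stem_pdiff z : disc 0 rho z ->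
  exists A C, pdiff stem_re z A (- C) /\ pdiff stem_im z C A.
Proof.
case: z => x y zr.
have [A dA] := regular_hol f_regular SI zr.
have [B dB] := regular_hol f_regular SI (disc_conj zr).
have {}dB := pdiff_comp (pdiff_fst (x, y)) (pdiffN (pdiff_snd (x, y))) dB.
have half (F : R * R -> H) z A' B' : pdiff F z A' B' ->
    pdiff (fun w => 2^-1 *: F w) z (2^-1 *: A') (2^-1 *: B').
  apply: (@pdiff_lin _ H H ( *:%R 2^-1) `|2^-1|) => [k u v|v].
    by rewrite scalerDr !scalerA mulrC.
  by rewrite normrZ.
exists (2^-1 *: (A + B)), (2^-1 *: (I * (B - A))); split.
  have := half _ _ _ _ (pdiffD dA dB); congr (pdiff _ _ _ _).
    by rewrite scale1r oppr0 scale0r addr0.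
  by rewrite scale0r add0r scaleN1r -mulrBr -scalerN -mulrN opprB.
have := half _ _ _ _ (pdiff_mull I (pdiffB dB dA)); congr (pdiff _ _ _ _).
  by rewrite scale1r oppr0 scale0r addr0.
rewrite scale0r add0r scaleN1r mulrBr mulrN !imag_unitMK // opprK.
by rewrite opprK addrC.
Qed.

(** Both sides are holomorphic on [L_J] and agree on the real axis. *)
Lemma representation_formula J z : imaginary_units R J -> disc 0 rho z ->
  f (slice_point J z.1 z.2) = stem_re z + J * stem_im z.
Proof.
move=> SJ zr; apply/eqP; rewrite -subr_eq0; apply/eqP.
apply: (vanishing_real_axis (F := fun z =>
  f (slice_point J z.1 z.2) - (stem_re z + J * stem_im z)) SJ _ _ zr).
  move=> w wr; apply: holB; first exact: regular_hol f_regular SJ wr.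
  by have [A [C [dA dC]]] := stem_pdiff wr; exact: stem_hol dA dC.
move=> [x y] _ /= ->; rewrite /stem_re /stem_im /= oppr0 !slice_pointE !scale0r.
rewrite !addr0 subrr !mulr0 scaler0 mulr0 addr0 scalerDr -scalerDl.
have -> : 2^-1 + 2^-1 = 1 :> R by field.
by rewrite scale1r subrr.
Qed.

End Slices.

(** * Regular conjugate and symmetrization *)

Section SymmetrizationAlgebra.
Context {R : realType}.
Local Notation H := (quaternion R).
Implicit Types (a b h w q X Y I J : H) (x y : R).

(** [sym_re a b + J sym_im a b] is the value at [x + J y] of the symmetrization
   [f^s] when [a + J b] is that of [f]. Its stem function has real components, so
   it maps each slice to itself. *)
Definition sym_re a b : R := dotq a a - dotq b b.
Definition sym_im a b : R := 2 * dotq a b.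

Lemma symmetrizationE I a b : conjq a * a + I * (conjq b * a + conjq a * b)
  - conjq b * b = slice_point I (sym_re a b) (sym_im a b).
Proof.
have E : conjq b * a + conjq a * b = (sym_im a b)%:A.
  by case: a b => [????] [????]; apply: quat_ext; rewrite /sym_im /dotq /=; ring.
rewrite E -scalerAr mulr1 addrAC slice_pointE; congr (_ + _).
case: a b E => [????] [????] _; apply: quat_ext; rewrite /sym_re /dotq /=; ring.
Qed.

Lemma symmetrization_swap I a b : a * conjq a + I * (b * conjq a + a * conjq b)
  - b * conjq b = slice_point I (sym_re a b) (sym_im a b).
Proof.
rewrite -[in RHS](conjqK a) -[in RHS](conjqK b).
have dotc (p q : H) : dotq (conjq p) (conjq q) = dotq p q.
  by rewrite /dotq /=; ring.
have -> : sym_re (conjq (conjq a)) (conjq (conjq b)) = sym_re (conjq a) (conjq b).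
  by rewrite /sym_re !dotc.
have -> : sym_im (conjq (conjq a)) (conjq (conjq b)) = sym_im (conjq a) (conjq b).
  by rewrite /sym_im !dotc.
by rewrite -symmetrizationE !conjqK.
Qed.

(** Since [h (h^-1 J h) = J h], the product is that of [conj a + J conj b] with
   [a + J b] computed as if [J] commuted with [a] and [b]. This makes the modulus of
   the regular reciprocal an inverse modulus of the function at a turned point. *)
Lemma conj_mul_stem J a b h : h = conjq a + J * conjq b -> h != 0 ->
  imaginary_units R J ->
  h * (a + invq h * J * h * b) = slice_point J (sym_re a b) (sym_im a b).
Proof.
move=> hE h0 SJ; rewrite mulrDr !mulrA mulqV // mul1r -symmetrizationE.
rewrite {h0}hE !mulrDl !mulrDr !mulrDl -!mulrA (imag_unitMK _ SJ).
by rewrite !addrA.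
Qed.

(** The turn inverse to that of [conj_mul_stem]: it gives the slice [L_J] and the point
   of it that is turned onto a prescribed point of [L_I]. *)
Lemma stem_mul_conj I J a b w : w = a + I * b -> w != 0 -> imaginary_units R I ->
  J = invq w * I * w ->
  w * (conjq a + J * conjq b) = slice_point I (sym_re a b) (sym_im a b).
Proof.
move=> wE w0 SI ->; rewrite mulrDr !mulrA mulqV // mul1r -symmetrization_swap.
rewrite {w0}wE !mulrDl !mulrDr !mulrDl -!mulrA (imag_unitMK _ SI).
by rewrite !addrA.
Qed.

(** The conjugate [h^-1 J h] depends continuously on [h], in the quantitative form
   used near a value [h0] where it equals [I]. *)
Lemma norm_conj_sub I J h h0 : imaginary_units R I -> imaginary_units R J ->
  J * h0 = h0 * I -> h != 0 ->
  `|invq h * J * h - I| * `|h| <= 2 * `|h - h0|.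
Proof.
move=> SI SJ JI hn0.
have -> : `|invq h * J * h - I| * `|h| = `|J * (h - h0) - (h - h0) * I|.
  rewrite mulrC -normqM mulrBr !mulrA mulqV // mul1r; congr (`|_|).
  by rewrite mulrBr mulrBl JI opprB addrA subrK.
apply: le_trans (ler_normB _ _) _.
by rewrite !normqM (norm_imag_unit SI) (norm_imag_unit SJ); lra.
Qed.

(** An element commuting with both [i] and [j] is real. *)
Lemma imag_unit_noncentral I : imaginary_units R I -> exists Y, I * Y != Y * I.
Proof.
move=> SI; apply: contrapT => no.
have comm Y : I * Y = Y * I by apply: contrapT => /eqP ne; apply: no; exists Y.
have := comm (Quat 0 1 0 0); have := comm (Quat 0 0 1 0).
have [_ {no comm}] := unit_imagP SI; case: I SI => a b c d _ /= n1.
move=> [] e1 e2 e3 e4 [] e5 e6 e7 e8.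
nra.
Qed.

End SymmetrizationAlgebra.

(** * The sphere through a local minimum point *)

Section MinimumModulus.
Context {R : realType}.
Local Notation H := (quaternion R).
Implicit Types (a b c h w q X Y I J : H) (x y : R) (z : R * R).

Lemma slice_point_dist I J x y x0 y0 : imaginary_units R J ->
  `|slice_point J x y - slice_point I x0 y0| <=
  `|x - x0| + `|y - y0| + `|y0| * `|J - I|.
Proof.
move=> SJ.
have -> : slice_point J x y - slice_point I x0 y0 =
    (x - x0)%:A + (y - y0) *: J + y0 *: (J - I).
  by apply: quat_ext; rewrite /slice_point /=; ring.
apply: le_trans (ler_normD _ _) _; rewrite normrZ lerD //.
apply: le_trans (ler_normD _ _) _; rewrite !normrZ (norm_imag_unit SJ) mulr1.
by rewrite normq1 mulr1.
Qed.

(** [|u a + I u b| = |u| |f (u^-1 (x + I y) u)|], so a local minimum makes the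
   quadratic form [|X a + I X b|^2 - |w|^2 |X|^2] nonnegative near its zero [1],
   and by the parallelogram identity everywhere. *)
Lemma quadratic_form_ge0 I a b w (d : R) : 0 < d -> w = a + I * b ->
  (forall u : H, `|u - 1| < d -> `|w| * `|u| <= `|u * a + I * (u * b)|) ->
  forall X : H, `|w| * `|X| <= `|X * a + I * (X * b)|.
Proof.
move=> d0 wE near1 X.
pose L Y := Y * a + I * (Y * b).
pose t := d / (2 * (`|X| + 1)).
have X1 : 0 < `|X| + 1 by rewrite ltr_wpDl.
have t0 : 0 < t by rewrite divr_gt0 // mulr_gt0.
have tX : `|t *: X| < d.
  rewrite normrZ gtr0_norm //.
  apply: (@le_lt_trans _ _ (t * (`|X| + 1))).
    by rewrite ler_wpM2l ?(ltW t0) // lerDl.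
  have -> : t * (`|X| + 1) = d / 2 by rewrite /t; field; rewrite gt_eqF.
  lra.
clearbody t.
have par (p q : H) : `|p + q| ^+ 2 + `|p - q| ^+ 2 = 2 * `|p| ^+ 2 + 2 * `|q| ^+ 2.
  by rewrite normqD_sqr normqB_sqr; ring.
have L1 : L 1 = w by rewrite /L !mul1r.
have LD (p q : H) : L (p + q) = L p + L q by rewrite /L !mulrDl mulrDr addrACA.
have LN (p : H) : L (- p) = - L p by rewrite /L !mulNr mulrN opprD.
have LZ (s : R) p : L (s *: p) = s *: L p.
  by rewrite /L -!scalerAl -scalerAr scalerDr.
have sq (u : H) : `|u - 1| < d -> `|w| ^+ 2 * `|u| ^+ 2 <= `|L u| ^+ 2.
  by move=> /near1 le1; rewrite -exprMn ler_sqr ?nnegrE ?mulr_ge0.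
have le1 : `|w| ^+ 2 * `|1 + t *: X| ^+ 2 <= `|w + t *: L X| ^+ 2.
  by rewrite -L1 -LZ -LD L1; apply: sq; rewrite addrC addKr.
have le2 : `|w| ^+ 2 * `|1 - t *: X| ^+ 2 <= `|w - t *: L X| ^+ 2.
  by rewrite -L1 -LZ -LN -LD L1; apply: sq; rewrite addrAC subrr sub0r normrN.
have := par w (t *: L X); have := par 1 (t *: X); rewrite normq1 expr1n !normrZ.
rewrite !exprMn real_normK ?num_real // => e1 e2.
rewrite -ler_sqr ?nnegrE ?mulr_ge0 // exprMn -/(L X).
have t20 : 0 < t ^+ 2 by rewrite exprn_gt0.
rewrite -(ler_pM2l t20).
have : `|w| ^+ 2 * (2 * 1 + 2 * (t ^+ 2 * `|X| ^+ 2)) <=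
  2 * `|w| ^+ 2 + 2 * (t ^+ 2 * `|L X| ^+ 2).
  by rewrite -e1 -e2 mulrDr; apply: lerD.
by lra.
Qed.

(** The form [X |-> X a + I X b] composed with [Y |-> Y conj a + I Y conj b] is the
   left multiplication by the symmetrization. If that vanished, the first form,
   being injective, would force the second to vanish, hence [a = b = 0]. *)
Lemma symmetrization_neq0 I a b w : imaginary_units R I -> w = a + I * b ->
  w != 0 -> (forall X : H, `|w| * `|X| <= `|X * a + I * (X * b)|) ->
  slice_point I (sym_re a b) (sym_im a b) != 0.
Proof.
move=> SI wE w0 Lge; apply/eqP => s0.
have L0 Y : Y * conjq a + I * (Y * conjq b) = 0.
  set Z := _ + _.
  have LZ : Z * a + I * (Z * b) = 0.
    have E := symmetrizationE I a b.
    have s_re : sym_re a b = 0 /\ sym_im a b = 0.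
      have := sqr_norm_slice_point (sym_re a b) (sym_im a b) SI.
      rewrite s0 normr0 expr0n /= => /esym/eqP.
      by rewrite paddr_eq0 ?sqr_ge0 // !sqrf_eq0 => /andP[/eqP-> /eqP->].
    have e1 : conjq a * a = conjq b * b.
      apply: quat_ext; move: s_re.1; rewrite /sym_re /dotq; case: (a); case: (b) => /= *; lra.
    have e2 : conjq b * a = - (conjq a * b).
      apply: quat_ext; move: s_re.2; rewrite /sym_im /dotq; case: (a); case: (b) => /= *; lra.
    rewrite /Z !mulrDl mulrDr -!mulrA (imag_unitMK _ SI) e1 e2 !mulrN.
    by rewrite addrA subrK subrr.
  by apply/eqP; rewrite -normr_le0 -(pmulr_rle0 _ (_ : 0 < `|w|)) ?normr_gt0 // (le_trans (Lge Z)) // LZ normr0.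
have a_E : conjq a = - (I * conjq b).
  by have := L0 1; rewrite !mul1r => /eqP; rewrite addr_eq0 => /eqP.
have [Y Yne] := imag_unit_noncentral SI.
have : (I * Y - Y * I) * conjq b = 0.
  by rewrite mulrBl addrC; have := L0 Y; rewrite a_E mulrN !mulrA.
move/(congr1 (fun q : H => `|q|)); rewrite normqM normr0 => /eqP.
rewrite mulf_eq0 !normr_eq0 subr_eq0 (negPf Yne) /= => /eqP b0.
have bb0 : b = 0 by rewrite -[b]conjqK b0; apply: quat_ext; rewrite /= ?oppr0.
have aa0 : a = 0.
  by rewrite -[a]conjqK a_E b0 mulr0 oppr0; apply: quat_ext; rewrite /= ?oppr0.
by move: w0; rewrite wE aa0 bb0 mulr0 addr0 eqxx.
Qed.

(** On the sphere [x0 + y0 S] the points near [x0 + I y0] include the turned points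
   [x0 + (u^-1 I u) y0] with [u] close to [1], where [f] takes the value
   [u^-1 (u a + I u b)]. *)
Lemma symmetrization_at_minimum I a b w x0 y0 (d : R) : imaginary_units R I ->
  w = a + I * b -> w != 0 -> 0 < d ->
  (forall J, imaginary_units R J ->
    `|slice_point J x0 y0 - slice_point I x0 y0| < d -> `|w| <= `|a + J * b|) ->
  slice_point I (sym_re a b) (sym_im a b) != 0.
Proof.
move=> SI wE w0 d0 w_min.
apply: (symmetrization_neq0 SI wE w0).
(* for [|u - 1| < d1 <= 1 / 2] the unit [u^-1 I u] is within [4 d1] of [I] *)
pose d1 := Num.min (1 / 2) (d / (4 * (`|y0| + 1))).
have y01 : 0 < `|y0| + 1 by rewrite ltr_wpDl.
have [d10 d1h d1d] : [/\ 0 < d1, d1 <= 1 / 2 & d1 <= d / (4 * (`|y0| + 1))].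
  by rewrite lt_min !ge_min !lexx orbT divr_gt0 // divr_gt0 // mulr_gt0.
clearbody d1.
apply: (quadratic_form_ge0 d10 wE) => u u1.
have nu : 1 / 2 < `|u|.
  by have := ler_normD u (1 - u); rewrite subrKC normq1 (distrC (1 : H)); lra.
have u0 : u != 0 by rewrite -normr_gt0; lra.
have SJ := imag_unit_conj u0 SI.
have JI : `|invq u * I * u - I| * `|u| <= 2 * `|u - 1|.
  by apply: norm_conj_sub => //; rewrite mulr1 mul1r.
have -> : u * a + I * (u * b) = u * (a + invq u * I * u * b).
  by rewrite mulrDr !mulrA mulqV // mul1r.
rewrite normqM mulrC ler_wpM2l //; apply: w_min => //.
apply: le_lt_trans (slice_point_dist _ _ _ _ _ SJ) _.
rewrite !subrr normr0 !add0r.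
have JI4 : `|invq u * I * u - I| <= 4 * d1.
  have := normr_ge0 (invq u * I * u - I); move: JI u1 nu.
  set k := `|_ - I|; set m := `|u|; set n := `|u - 1|; nra.
have dd : d1 * (4 * (`|y0| + 1)) <= d by rewrite -ler_pdivlMr // mulr_gt0.
have := normr_ge0 (invq u * I * u - I); have := normr_ge0 y0.
move: JI4 dd d10; set k := `|_ - I|; set m := `|y0|; nra.
Qed.

(** Continuity at [z0] of the turned point: there the turn carries the unit [J]
   to [I]. *)
Lemma turned_point_near I J (h : R * R -> H) z0 (d : R) : imaginary_units R I ->
  imaginary_units R J -> {for z0, continuous h} -> h z0 != 0 ->
  J * h z0 = h z0 * I -> 0 < d ->
  \forall z \near z0, `|slice_point (invq (h z) * J * h z) z.1 z.2
                         - slice_point I z0.1 z0.2| < d.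
Proof.
case: z0 => x0 y0 SI SJ cont_h h0 Jh0 d0.
set z0 : R * R := (x0, y0) in cont_h h0 Jh0 *.
have nh0 : 0 < `|h z0| by rewrite normr_gt0.
have y01 : 0 < 16 * (`|y0| + 1) by rewrite mulr_gt0 // ltr_wpDl.
(* [|h - h z0| < e] puts the turned unit within [4 e / |h z0|] of [I], hence
   moves the point by at most [d / 4] *)
pose e := Num.min (`|h z0| / 2) (`|h z0| * d / (16 * (`|y0| + 1))).
have [e0 eh ed] : [/\ 0 < e, e <= `|h z0| / 2
    & e <= `|h z0| * d / (16 * (`|y0| + 1))].
  by rewrite lt_min !ge_min !lexx orbT !divr_gt0 // mulr_gt0.
have d4 : 0 < d / 4 by rewrite divr_gt0.
have c1 := pdiff_continuous (pdiff_fst z0).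
have c2 := pdiff_continuous (pdiff_snd z0).
have /cvgrPdist_lt/(_ _ e0) near_h := cont_h.
have /cvgrPdist_lt/(_ _ d4) near1 := c1.
have /cvgrPdist_lt/(_ _ d4) near2 := c2.
near=> z.
have hz : `|h z0 - h z| < e by near: z; exact: near_h.
have z1 : `|x0 - z.1| < d / 4 by near: z; exact: near1.
have z2 : `|y0 - z.2| < d / 4 by near: z; exact: near2.
have nhz : `|h z0| / 2 <= `|h z|.
  have := ler_normD (h z) (h z0 - h z); rewrite subrKC; lra.
have hz0 : h z != 0 by rewrite -normr_gt0; lra.
pose T := invq (h z) * J * h z.
have TI : `|T - I| * `|h z| <= 2 * `|h z - h z0| by exact: norm_conj_sub.
have ST : imaginary_units R T by exact: imag_unit_conj.
apply: le_lt_trans (slice_point_dist _ _ _ _ _ ST) _.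
rewrite (distrC z.1) (distrC z.2) /=.
suff : `|y0| * `|T - I| <= d / 4 by lra.
have TI2 : `|T - I| * `|h z0| <= 4 * e.
  move: TI hz nhz; rewrite (distrC (h z)).
  have := normr_ge0 (T - I); set t := `|T - I|; nra.
have TI3 : `|T - I| * (4 * (`|y0| + 1)) <= d.
  rewrite -(ler_pM2r nh0) -mulrA [_ * `|h z0|]mulrC mulrA.
  move: ed; rewrite ler_pdivlMr // => ed.
  apply: (@le_trans _ _ (4 * e * (4 * (`|y0| + 1)))).
    by rewrite ler_wpM2r // mulr_ge0 // addr_ge0.
  by rewrite [d * _]mulrC; move: ed; lra.
have := normr_ge0 (T - I); have := normr_ge0 y0; move: TI3.
set t := `|T - I|; set m := `|y0|; nra.
Unshelve. all: by end_near. Qed.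

(** With [k = |c|^2] the hypotheses say that the complex number [s + i t] satisfies
   [sigma = sigma^2 k], whose solutions are [0] and [1 / k]. *)
Lemma idempotent_symmetrization (k s t : R) : 0 < k ->
  s = (s ^+ 2 - t ^+ 2) * k -> t = 2 * (s * t) * k ->
  t = 0 /\ (s ^+ 2 + t ^+ 2 != 0 -> s * k = 1).
Proof.
move=> k0 e1 e2.
have t0 : t = 0.
  apply/eqP/negP => /negP t0.
  have sk : 2 * s * k = 1 by apply: (mulfI t0); rewrite mulr1 [RHS]e2; ring.
  have : 0 < t ^+ 2 * k by rewrite mulr_gt0 // exprn_even_gt0.
  by nra.
split=> // n0; have s0 : s != 0.
  by move: n0; rewrite t0 expr0n /= addr0 sqrf_eq0.
by apply: (mulfI s0); rewrite mulr1 [RHS]e1 t0; ring.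
Qed.

End MinimumModulus.

(** * The regular reciprocal *)

Section StemHolomorphic.
Context {R : realType}.
Local Notation H := (quaternion R).

Lemma stem_conj_hol J (al be : R * R -> H) z A C : imaginary_units R J ->
  pdiff al z A (- C) -> pdiff be z C A ->
  hol J (fun w => conjq (al w) + J * conjq (be w)) z.
Proof.
move=> SJ dal dbe; apply: (stem_hol SJ (A := conjq A) (C := conjq C)).
  exact: (pdiff_conjq dal).
exact: pdiff_conjq.
Qed.

(** In coordinates the symmetrization is the sum of the squares of the four
   complex functions [al_i + J be_i], which are holomorphic. *)
Lemma symmetrization_cauchy_riemann (al be : R * R -> H) z A C :
  pdiff al z A (- C) -> pdiff be z C A ->
  exists x y, pdiff (fun w => sym_re (al w) (be w)) z x (- y) /\
    pdiff (fun w => sym_im (al w) (be w)) z y x.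
Proof.
move=> dal dbe.
exists (2 * dotq A (al z) - 2 * dotq C (be z)).
exists (2 * (dotq A (be z) + dotq (al z) C)).
split.
  have := pdiffB (pdiff_dotq dal dal) (pdiff_dotq dbe dbe).
  by congr (pdiff _ _ _ _); rewrite /dotq /=; ring.
have := pdiffM (pdiff_cst (2 : R) z) (pdiff_dotq dal dbe).
by congr (pdiff _ _ _ _); rewrite /dotq /=; ring.
Qed.

Lemma near_neq0 (V : normedModType R) (F : R * R -> V) z :
  {for z, continuous F} -> F z != 0 -> \forall w \near z, F w != 0.
Proof.
move=> cF Fz.
have n0 : 0 < `|F z| by rewrite normr_gt0.
have /cvgrPdist_lt/(_ _ n0) := cF; apply: filterS => w lt1.
by apply/eqP => Fw; move: lt1; rewrite Fw subr0 ltxx.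
Qed.

Lemma local_minimum_radius (f : H -> H) (p : H) :
  (\forall q \near p, `|f p| <= `|f q|) ->
  exists2 d, 0 < d & forall q, `|q - p| < d -> `|f p| <= `|f q|.
Proof.
move=> /nbhs_normP[d /= d0 Hd]; exists d => // q qp; apply: Hd => /=.
by rewrite distrC.
Qed.

End StemHolomorphic.

Theorem theorem1p3 (R : realType) (r : R) (r_gt0 : 0 < r)
    (f : quaternion R -> quaternion R)
    (f_regular : cullen_regular (ball (0 : quaternion R) r) f)
    (p : quaternion R) (Bp : ball (0 : quaternion R) r p)
    (p_min : \forall q \near p, `|f p| <= `|f q|) :
  f p = 0 \/
  exists c : quaternion R, forall q, ball (0 : quaternion R) r q -> f q = c.
Proof.
have [fp0|w0] := eqVneq (f p) 0; [by left|right].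
have [I [x0 [y0 [SI pE]]]] := slice_point_exists p.
have [d d0 p_le] := local_minimum_radius p_min.
pose z0 : R * R := (x0, y0).
have z0r : disc 0 r z0 by apply/(ball_slice_point _ _ _ SI); rewrite -pE.
pose al := stem_re f I; pose be := stem_im f I.
have rep J z : imaginary_units R J -> disc 0 r z ->
    f (slice_point J z.1 z.2) = al z + J * be z.
  exact: representation_formula.
have diff_stem z : disc 0 r z ->
    exists A C, pdiff al z A (- C) /\ pdiff be z C A.
  exact: stem_pdiff.
pose w := f p.
have wE : w = al z0 + I * be z0 by rewrite /w pE -(rep I z0).
pose s1 z := sym_re (al z) (be z); pose s2 z := sym_im (al z) (be z).
have sI0 : slice_point I (s1 z0) (s2 z0) != 0.
  apply: (symmetrization_at_minimum (x0 := x0) (y0 := y0) SI wE w0 d0) => J SJ Jd.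
  by rewrite -(rep J z0) //; apply: p_le; rewrite pE.
(* the slice on which the turned point of [z0] is [p] *)
pose J := invq w * I * w.
have SJ : imaginary_units R J by exact: imag_unit_conj.
pose h z := conjq (al z) + J * conjq (be z).
have wh0 : w * h z0 = slice_point I (s1 z0) (s2 z0) by exact: stem_mul_conj.
have h0 : h z0 != 0 by apply: contra sI0 => /eqP E; rewrite -wh0 E mulr0.
have Jh0 : J * h z0 = h z0 * I.
  rewrite -[LHS]mul1r -[RHS]mul1r -(mulVq w0) -!mulrA; congr (_ * _).
  rewrite !mulrA (mulqV w0) mul1r -!mulrA wh0 mulrA wh0 slice_pointE.
  by rewrite mulrDr mulrDl -!scalerAr -!scalerAl mulr1 mul1r.
have hol_h z : disc 0 r z -> hol J h z.
  by move=> /diff_stem[A [C [dA dC]]]; exact: stem_conj_hol dA dC.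
have CR z : disc 0 r z -> exists x y, pdiff s1 z x (- y) /\ pdiff s2 z y x.
  by move=> /diff_stem[A [C [dA dC]]]; exact: symmetrization_cauchy_riemann dA dC.
pose n z := s1 z ^+ 2 + s2 z ^+ 2.
have nE K z : imaginary_units R K -> n z = `|slice_point K (s1 z) (s2 z)| ^+ 2.
  by move=> SK; rewrite sqr_norm_slice_point.
have n0 : n z0 != 0 by rewrite (nE I) // sqrf_eq0 normr_eq0.
(* the regular reciprocal [(f^s)^-1 f^c] of [f], on [L_J] *)
pose G z := slice_point J (s1 z / n z) (- s2 z / n z) * h z.
have sG z : n z != 0 -> slice_point J (s1 z) (s2 z) * G z = h z.
  move=> nz; rewrite /G mulrA.
  by rewrite slice_pointV ?mul1r.
(* [T z] is the unit of the turned point, at which the modulus of [f] is the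
   inverse of that of [G z] *)
pose T z := invq (h z) * J * h z.
have hT z : disc 0 r z -> h z != 0 ->
    h z * f (slice_point (T z) z.1 z.2) = slice_point J (s1 z) (s2 z).
  move=> zr hz; rewrite rep //; last exact: imag_unit_conj.
  exact: conj_mul_stem.
have GT z : disc 0 r z -> h z != 0 -> n z != 0 ->
    `|G z| * `|f (slice_point (T z) z.1 z.2)| = 1.
  move=> zr hz nz; apply: (mulIf (_ : `|h z| != 0)); first by rewrite normr_eq0.
  rewrite -mulrA [X in _ * X]mulrC -normqM (hT z zr hz) mulrC -normqM sG //.
  by rewrite mul1r.
have T0 : T z0 = I by rewrite /T -mulrA Jh0 mulrA mulVq // mul1r.
have near_good : \forall z \near z0, [/\ disc 0 r z, h z != 0, n z != 0
    & `|slice_point (T z) z.1 z.2 - p| < d].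
  have cont_h := hol_continuous (hol_h z0 z0r).
  have [x [y [ds1 ds2]]] := CR z0 z0r.
  have near_n : \forall z \near z0, n z != 0.
    apply: near_neq0 n0.
    exact: pdiff_continuous (pdiffD (pdiffM ds1 ds1) (pdiffM ds2 ds2)).
  have near_T : \forall z \near z0, `|slice_point (T z) z.1 z.2 - p| < d.
    by rewrite pE; exact: turned_point_near SI SJ cont_h h0 Jh0 d0.
  apply: filterS (filterI (filterI (disc_nbhs z0r) (near_neq0 cont_h h0))
                          (filterI near_n near_T)).
  by move=> z [[zr hz] [nz Tz]].
have [rho rho0 good] := nbhs_disc near_good.
have G_const z : disc z0 rho z -> G z = G z0.
  apply: (@strong_maximum _ J) => // z' /good[zr hz nz zp].
    have [x [y [d1 d2]]] := CR z' zr.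
    have [x' [y' [d3 d4]]] := inv_cauchy_riemann nz d1 d2.
    exact: hol_slice_scale d3 d4 (hol_h _ zr).
  have := GT z' zr hz nz; have := GT z0 z0r h0 n0.
  rewrite T0 -pE => Gz0 Gz.
  have fp : 0 < `|f p| by rewrite normr_gt0.
  by rewrite -(ler_pM2r fp) Gz0 -Gz ler_wpM2l //; exact: p_le.
pose c := G z0.
have h_eq z : disc 0 r z -> h z = slice_point J (s1 z) (s2 z) * c.
  move=> zr; apply/eqP; rewrite -subr_eq0; apply/eqP; move: z zr.
  apply: (identity_theorem SJ (a := z0)) => //.
    move=> z zr; apply: holB; first exact: hol_h.
    have [x [y [d1 d2]]] := CR z zr.
    exact: hol_slice_scale d1 d2 (hol_cst J c z).
  have := disc_nbhs (disc_center z0 rho0); apply: filterS => z zr.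
  have [_ _ nz _] := good z zr.
  by rewrite -{1}(sG z nz) (G_const z zr) subrr.
(* compare [h_eq] at the conjugate points [z.1 + J z.2] and [z.1 - J z.2] *)
have stem_c z : disc 0 r z -> conjq (al z) = s1 z *: c /\ conjq (be z) = s2 z *: c.
  case: z => x y zr; have e1 := h_eq _ zr; have := h_eq _ (disc_conj zr).
  rewrite /h /s1 /s2 /al /be stem_re_conj stem_im_conj -/al -/be.
  have -> : sym_re (al (x, y)) (- be (x, y)) = s1 (x, y).
    by rewrite /s1 /sym_re /dotq /=; ring.
  have -> : sym_im (al (x, y)) (- be (x, y)) = - s2 (x, y).
    by rewrite /s2 /sym_im /dotq /=; ring.
  have E t t' : slice_point J t t' * c = t *: c + J * (t' *: c).
    by rewrite slice_pointE mulrDl -!scalerAl -scalerAr mul1r.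
  move: e1; rewrite /h !E conjqN scaleNr !mulrN => e1 e2.
  exact: slice_stem_inj SJ e1 e2.
have c0 : c != 0.
  by apply: contra h0 => /eqP E; rewrite -(sG z0 n0) -/c E mulr0.
pose k := `|c| ^+ 2.
have k0 : 0 < k by rewrite exprn_gt0 // normr_gt0.
have s_idem z : disc 0 r z -> s2 z = 0 /\ (n z != 0 -> s1 z * k = 1).
  move=> zr; have [aE bE] := stem_c z zr.
  apply: idempotent_symmetrization k0 _ _.
    rewrite {1}/s1 /sym_re -!sqr_normq -(norm_conjq (al z)) -(norm_conjq (be z)) aE bE.
    by rewrite !normrZ !exprMn !real_normK ?num_real // mulrBl.
  rewrite {1}/s2 /sym_im.
  have -> : dotq (al z) (be z) = dotq (conjq (al z)) (conjq (be z)).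
    by rewrite /dotq /=; ring.
  by rewrite aE bE /k sqr_normq /dotq /=; ring.
pose m := k^-1 *: c.
have h_const z : disc 0 r z -> h z = m.
  move=> zr; apply/eqP; rewrite -subr_eq0; apply/eqP; move: z zr.
  apply: (identity_theorem SJ (a := z0)) => //.
    by move=> z zr; apply: holB; [exact: hol_h|exact: hol_cst].
  have := disc_nbhs (disc_center z0 rho0); apply: filterS => z /good[zr _ nz _].
  have [s20 /(_ nz) s1k] := s_idem z zr.
  rewrite h_eq // s20 slice_pointE scale0r addr0 -scalerAl mul1r.
  have -> : s1 z = k^-1 by apply: (mulIf (lt0r_neq0 k0)); rewrite s1k mulVf // gt_eqF.
  by rewrite subrr.
exists (conjq m) => q Bq.
have [K [x [y [SK qE]]]] := slice_point_exists q.
have zr : disc 0 r (x, y) by apply/(ball_slice_point _ _ _ SK); rewrite -qE.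
rewrite qE (rep K (x, y)) //.
have := h_const _ zr; have := h_const _ (disc_conj zr).
rewrite /h /al /be stem_re_conj stem_im_conj -/al -/be => e2 e1.
have [aE bE] : conjq (al (x, y)) = m /\ conjq (be (x, y)) = 0.
  apply: (slice_stem_inj SJ); first by rewrite mulr0 addr0.
  by rewrite mulr0 subr0 -mulrN -conjqN.
rewrite -aE conjqK -[be _]conjqK bE.
have -> : conjq 0 = 0 :> quaternion R by apply: quat_ext; rewrite /= ?oppr0.
by rewrite mulr0 addr0.
Qed.
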